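(* Let $\mathfrak g$ be a contragredient Lie algebra of finite growth with symmetrizable Cartan matrix, let $\mathcal A$ be a $\mathfrak g$-admissible algebra, and let $\alpha$ be a real root of $\mathfrak g$. Then the map $$q_\alpha:\ {}_{\mathfrak n_\alpha}\mathcal A_{\mathfrak n_{-\alpha}}\longrightarrow Z^{\mathfrak n_\alpha}(\mathcal A)$$ is a homomorphism of algebras, that is, $q_\alpha(a\circ b)=q_\alpha(a)\,q_\alpha(b)$ for all $a,b\in {}_{\mathfrak n_\alpha}\mathcal A_{\mathfrak n_{-\alpha}}$, where $\circ$ is the multiplication of the double coset algebra.
   Context: The ground field is $\mathbb C$. $\mathfrak g$ is a contragredient (Kac–Moody) Lie algebra of finite growth with symmetrizable Cartan matrix $(a_{i,j})$, Gauss decomposition $\mathfrak g=\mathfrak n_-+\mathfrak h+\mathfrak n$, simple roots $\Pi=\{\alpha_i\}$, root system $\Delta=\Delta_+\sqcup\Delta_-$, and set of real roots $\Delta^{re}$. Chevalley generators $e_{\pm\alpha_i}$, $h_{\alpha_i}\in\mathfrak h$ satisfy $[e_{\alpha_i},e_{-\alpha_j}]=\delta_{i,j}h_{\alpha_i}$, $[h_{\alpha_i},e_{\pm\alpha_j}]=\pm a_{i,j}e_{\pm\alpha_j}$ and the Serre relations; $d_i\in\mathbb N$ are such that $(\alpha_i,\alpha_j)=d_ia_{i,j}=d_ja_{j,i}$. For a root $\gamma=\sum n_i\alpha_i$ put $t_\gamma=\sum n_id_ih_{\alpha_i}$; $h_\gamma=2t_\gamma/(\gamma,\gamma)$ (the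 coroot) if $\gamma$ is real, $h_\gamma=t_\gamma$ if $\gamma$ is imaginary. For real $\gamma$, $e_{\pm\gamma}$ are root vectors of weight $\pm\gamma$ with $[e_\gamma,e_{-\gamma}]=h_\gamma$. $D$ is the localization of $U(\mathfrak h)$ at the multiplicative set generated by $\{h_\gamma+k:\gamma\in\Delta,k\in\mathbb Z\}$. For an integral weight $\mu\in\mathfrak h^*$, $\tau_\mu$ is the automorphism of $D$ with $\tau_\mu(h)=h+\langle h,\mu\rangle$, $h\in\mathfrak h$. An associative algebra $\mathcal A$ containing $U(\mathfrak g)$ as a subalgebra carries the adjoint action of $U(\mathfrak g)$, denoted $\hat g(a)=\mathrm{ad}_g(a)$, with $\hat g(a)=ga-ag$ for $g\in\mathfrak g$. $\mathcal A$ is called $\mathfrak g$-admissible if: (a) there is a subspace $\mathcal V\subset\mathcal A$, invariant under the adjoint action of $U(\mathfrak g)$, such that multiplication induces isomorphisms of vector spaces $U(\mathfrak g)\otimes\mathcal V\to\mathcal A$ and $\mathcal V\otimes U(\mathfrak g)\to\mathcal A$; (b) the adjoint action on $\mathcal V$ of every real root vector $e_\gamma$ is locally nilpotent, and the adjoint action of $\mathfrak h$ on $\mathcal V$ is semisimple. Put $\mathcal A'=D\otimes_{U(\mathfrak h)}\mathcal A$ (the localized algebra, containing $\mathcal A$). Put $\mathfrak n_{\pm\alpha}=\mathbb Ce_{\pm\alpha}$. Mickelsson algebra: $Z^{\mathfrak n_\alpha}(\mathcal A)=\{x\in\mathcal A': e_\alpha x\in\mathcal A'e_\alpha\}/\mathcal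 A'e_\alpha$, with multiplication induced from $\mathcal A'$. Double coset algebra: ${}_{\mathfrak n_\alpha}\mathcal A_{\mathfrak n_{-\alpha}}=\mathcal A'/(e_\alpha\mathcal A'+\mathcal A'e_{-\alpha})$ with multiplication $a\circ b=$ class of $x\cdot p_{-\alpha}(y)$, where $x,y\in\mathcal A'$ represent $a,b$ and $$p_{-\alpha}(y)=\sum_{m\ge0}\frac1{m!}\,\frac{1}{(h_\alpha-2)(h_\alpha-3)\cdots(h_\alpha-m-1)}\,e_\alpha^m e_{-\alpha}^m\,y\ \in\ \mathcal A'/\mathcal A'e_{-\alpha}$$ (the action of the extremal projector of the $\mathfrak{sl}_2$-subalgebra spanned by $e_{\pm\alpha},h_\alpha$, relative to $\mathfrak n_{-\alpha}$; the sum is finite in $\mathcal A'/\mathcal A'e_{-\alpha}$). This is a well-defined associative multiplication. The Zhelobenko map $q_\alpha:\mathcal A'\to\mathcal A'/\mathcal A'e_\alpha$ is defined by $$q_\alpha(x)=\sum_{n\ge0}\frac{(-1)^n}{n!}\,\hat e_\alpha^{\,n}(x)\,e_{-\alpha}^n\,\big(h_\alpha(h_\alpha-1)\cdots(h_\alpha-n+1)\big)^{-1}\mod \mathcal A'e_\alpha,\qquad x\in\mathcal A,$$ and extended to $\mathcal A'$ by $q_\alpha(xd)=q_\alpha(x)\tau_\alpha(d)$, $d\in D$. It vanishes on $e_\alpha\mathcal A'+\mathcal A'e_{-\alpha}$ and its image lies in $Z^{\mathfrak n_\alpha}(\mathcal A)$, so it induces a map ${}_{\mathfrak n_\alpha}\mathcal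 A_{\mathfrak n_{-\alpha}}\to Z^{\mathfrak n_\alpha}(\mathcal A)$, denoted by the same symbol. *)

(* Defs.v *)
From HB Require Import structures.
From mathcomp Require Import all_boot all_order all_algebra.
From mathcomp Require Import generic_quotient ring_quotient.
From mathcomp Require Import boolp classical_sets cardinality fsbigop reals.
From mathcomp Require Import complex.

Set Implicit Arguments.
Unset Strict Implicit.
Unset Printing Implicit Defensive.

Import GRing.Theory.
Local Open Scope ring_scope.
Local Open Scope quotient_scope.

HB.mixin Record Lmodule_isLie (K : fieldType) L of GRing.Lmodule K L := {
  lie : L -> L -> L;
  lie_linearl : forall y, linear (lie^~ y);
  lie_linearr : forall x, linear (lie x);
  liexx : forall x, lie x x = 0;
  lie_jacobi : forall x y z,
    lie x (lie y z) + lie y (lie z x) + lie z (lie x y) = 0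
}.

#[short(type="lieAlgType")]
HB.structure Definition LieAlgebra (K : fieldType) :=
  {L of GRing.Lmodule K L & Lmodule_isLie K L}.

Definition abelian_lie (K : fieldType) (V : lmodType K) : Type := V.

HB.instance Definition _ (K : fieldType) (V : lmodType K) :=
  GRing.Lmodule.on (abelian_lie V).

Fact abelian_lie_linear (K : fieldType) (V : lmodType K) :
  linear (fun _ : abelian_lie V => 0 : abelian_lie V).
Proof. by move=> a x y; rewrite scaler0 addr0. Qed.

Fact abelian_lie_jacobi (K : fieldType) (V : lmodType K) :
  (0 + 0 + 0 : abelian_lie V) = 0.
Proof. by rewrite !addr0. Qed.

HB.instance Definition _ (K : fieldType) (V : lmodType K) :=
  Lmodule_isLie.Build K (abelian_lie V)
    (fun _ => @abelian_lie_linear K V) (fun _ => @abelian_lie_linear K V)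
    (fun _ => erefl) (fun _ _ _ => @abelian_lie_jacobi K V).

Definition rcomm (B : pzRingType) (a b : B) : B := a * b - b * a.

Definition lie_rep (K : fieldType) (L : lieAlgType K) (B : algType K)
    (f : L -> B) : Prop :=
  forall x y, f (lie x y) = rcomm (f x) (f y).

Definition is_enveloping (K : fieldType) (L : lieAlgType K) (U : algType K)
    (i : {linear L -> U}) : Prop :=
  lie_rep i /\
  forall (B : algType K) (f : {linear L -> B}), lie_rep f ->
    exists F : {lrmorphism U -> B},
      (forall x, F (i x) = f x) /\
      (forall G : {lrmorphism U -> B}, (forall x, G (i x) = f x) -> G =1 F).

(* [b] exhibits [T] as the tensor product over [B] of the right module [M]
   and the left module [N]. *)
Definition is_tensor_over (K : fieldType) (B : Type) (M N T : lmodType K)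
    (ract : M -> B -> M) (lact : B -> N -> N) (b : M -> N -> T) : Prop :=
  let balanced (W : lmodType K) (f : M -> N -> W) :=
    [/\ forall n, linear (f^~ n), forall m, linear (f m)
      & forall m c n, f (ract m c) n = f m (lact c n)] in
  balanced T b /\
  forall (W : lmodType K) (f : M -> N -> W), balanced W f ->
    exists F : {linear T -> W},
      (forall m n, F (b m n) = f m n) /\
      (forall G : {linear T -> W}, (forall m n, G (b m n) = f m n) -> G =1 F).

Definition is_tensor (K : fieldType) (M N T : lmodType K) (b : M -> N -> T) :=
  is_tensor_over (fun m (c : K) => c *: m) (fun (c : K) n => c *: n) b.

(* [a i j] is the value of the simple root alpha_j on the simple coroot
   h_{alpha_i}. *)
Definition generalized_cartan (n : nat) (a : 'M[int]_n) : Prop :=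
  [/\ forall i, a i i = 2,
      forall i j, i != j -> a i j <= 0
    & forall i j, a i j = 0 -> a j i = 0].

Definition symmetrizer (n : nat) (a : 'M[int]_n) (d : 'I_n -> nat) : Prop :=
  (forall i, (0 < d i)%N) /\
  (forall i j, (d i)%:R * a i j = (d j)%:R * a j i).

Definition lie_subalgebra (K : fieldType) (L : lieAlgType K) (P : L -> Prop) :=
  [/\ P 0, forall (c : K) x y, P x -> P y -> P (c *: x + y)
    & forall x y, P x -> P y -> P (lie x y)].

Definition lie_ideal (K : fieldType) (L : lieAlgType K) (P : L -> Prop) :=
  [/\ P 0, forall (c : K) x y, P x -> P y -> P (c *: x + y)
    & forall x y, P y -> P (lie x y)].

(* The Lie algebra g(A) of a generalized Cartan matrix A, for a minimal
   realization (cartan, simple roots, simple coroots) of A.  The Serre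
   relations follow from the other fields. *)
Record contragredient (K : fieldType) := Contragredient {
  rk : nat;
  cmat : 'M[int]_rk;
  cartan : vectType K;
  coroot : 'I_rk -> cartan;
  sroot : 'I_rk -> 'Hom(cartan, K^o);
  csort :> lieAlgType K;
  inc : {linear cartan -> csort};
  chev_e : 'I_rk -> csort;
  chev_f : 'I_rk -> csort;
  cmat_gcm : generalized_cartan cmat;
  coroot_free : free [seq coroot i | i : 'I_rk];
  sroot_free : free [seq sroot i | i : 'I_rk];
  sroot_coroot : forall i j, sroot j (coroot i) = (cmat i j)%:~R;
  cartan_dim :
    (\dim {:cartan} + \rank (map_mx intr cmat : 'M[K]_rk) = rk.*2)%N;
  inc_inj : injective inc;
  lie_hh : forall h h', lie (inc h) (inc h') = 0;
  lie_he : forall h i, lie (inc h) (chev_e i) = (sroot i h : K) *: chev_e i;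
  lie_hf : forall h i, lie (inc h) (chev_f i) = - (sroot i h : K) *: chev_f i;
  lie_ef : forall i j,
    lie (chev_e i) (chev_f j) = if i == j then inc (coroot i) else 0;
  serre_e : forall i j, i != j ->
    iter `|1 - cmat i j|%N (lie (chev_e i)) (chev_e j) = 0;
  serre_f : forall i j, i != j ->
    iter `|1 - cmat i j|%N (lie (chev_f i)) (chev_f j) = 0;
  chev_gen : forall P : csort -> Prop, lie_subalgebra P ->
    (forall h, P (inc h)) -> (forall i, P (chev_e i)) ->
    (forall i, P (chev_f i)) -> forall x, P x;
  no_ideal : forall P : csort -> Prop, lie_ideal P ->
    (forall h, P (inc h) -> h = 0) -> forall x, P x -> x = 0
}.

(* Elements of the root lattice are row vectors of integers, in the basis of
   simple roots. *)
Definition weight (K : fieldType) (g : contragredient K) (c : 'rV[int]_(rk g))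
    (h : cartan g) : K :=
  \sum_i (c 0 i)%:~R * (sroot i h : K).

Definition root_space (K : fieldType) (g : contragredient K)
    (c : 'rV[int]_(rk g)) (x : g) : Prop :=
  forall h : cartan g, lie (inc g h) x = weight c h *: x.

Definition root (K : fieldType) (g : contragredient K)
    (c : 'rV[int]_(rk g)) : Prop :=
  c != 0 /\ exists x : g, x != 0 /\ root_space c x.

Definition simple_reflection (n : nat) (a : 'M[int]_n) (i : 'I_n)
    (c : 'rV[int]_n) : 'rV[int]_n :=
  c - (\sum_j a i j * c 0 j) *: delta_mx 0 i.

Definition real_root (K : fieldType) (g : contragredient K)
    (c : 'rV[int]_(rk g)) : Prop :=
  exists (w : seq 'I_(rk g)) (i : 'I_(rk g)),
    c = foldr (simple_reflection (cmat g)) (delta_mx 0 i) w.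

Definition height (n : nat) (c : 'rV[int]_n) : int := \sum_i c 0 i.

Definition principal_piece (K : fieldType) (g : contragredient K) (k : int)
    (x : g) : Prop :=
  exists s : seq g, x = \sum_(y <- s) y /\
    forall y, y \in s -> exists c, root_space c y /\ height c = k.

(* The dimensions of the pieces of the principal grading (deg chev_e = 1,
   deg chev_f = -1) are bounded by a polynomial. *)
Definition finite_growth (K : fieldType) (g : contragredient K) : Prop :=
  exists m r : nat, forall k : int, exists s : seq g,
    (size s <= m * (`|k|%N + 1) ^ r)%N /\
    forall x, principal_piece k x ->
      exists a : 'I_(size s) -> K, x = \sum_i a i *: s`_i.

Definition root_form (n : nat) (a : 'M[int]_n) (d : 'I_n -> nat)
    (c c' : 'rV[int]_n) : int :=
  \sum_i \sum_j c 0 i * c' 0 j * ((d i)%:R * a i j).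

Definition root_t (K : fieldType) (g : contragredient K)
    (d : 'I_(rk g) -> nat) (c : 'rV[int]_(rk g)) : cartan g :=
  \sum_i (c 0 i * (d i)%:R)%:~R *: coroot i.

Definition root_h (K : fieldType) (g : contragredient K)
    (d : 'I_(rk g) -> nat) (c : 'rV[int]_(rk g)) : cartan g :=
  if `[< real_root (g := g) c >]
  then (2 / (root_form (cmat g) d c c)%:~R) *: root_t d c
  else root_t d c.

(* The hat action of [x] in g on [A] is [rcomm (jA (iU x))]; a subspace is
   stable under the adjoint action of U(g) iff it is stable under that of g.
   The semisimplicity of the action of the Cartan subalgebra means that every
   element is a finite sum of weight vectors. *)
Definition admissible (K : fieldType) (g : contragredient K) (U A : algType K)
    (iU : {linear g -> U}) (jA : {lrmorphism U -> A}) : Prop :=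
  exists (P : pred A) (V : subLmodType P),
  [/\ forall (x : g) (v : V), P (rcomm (jA (iU x)) (val v)),
      is_tensor (fun (u : U) (v : V) => jA u * val v),
      is_tensor (fun (v : V) (u : U) => val v * jA u),
      forall c, real_root c -> forall x : g, root_space c x ->
        forall v : V, exists n, iter n (rcomm (jA (iU x))) (val v) = 0
    & forall v : V, exists s : seq V, v = \sum_(w <- s) w /\
        forall w, w \in s -> exists mu : 'Hom(cartan g, K^o),
          forall h, rcomm (jA (iU (inc g h))) (val w) = (mu h : K) *: val w].

Definition denominator (K : fieldType) (g : contragredient K)
    (d : 'I_(rk g) -> nat) (Uh : comAlgType K)
    (iH : {linear abelian_lie (cartan g) -> Uh}) (s : Uh) : Prop :=
  exists r : seq ('rV[int]_(rk g) * int),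
    (forall p, p \in r -> root (g := g) p.1) /\
    s = \prod_(p <- r) (iH (root_h d p.1) + p.2%:~R).

(* [S] is multiplicatively closed, and contains 1, in the use below. *)
Definition is_localization (B : comNzRingType) (S : B -> Prop)
    (D : comUnitRingType) (l : {rmorphism B -> D}) : Prop :=
  [/\ forall s, S s -> l s \is a GRing.unit,
      forall x : D, exists b s, S s /\ x = l b / l s
    & forall b b', l b = l b' -> exists2 s, S s & s * b = s * b'].

(* [A'] is the tensor product over U(h) of [D] and [A], with an algebra
   structure extending those of [D] and [A]; [m] is the embedding of U(h) in
   U(g). *)
Definition is_localized_algebra (K : fieldType) (U A A' : algType K)
    (Uh : comAlgType K) (D : comUnitAlgType K)
    (m : {lrmorphism Uh -> U}) (jA : {lrmorphism U -> A})
    (l : {lrmorphism Uh -> D})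
    (dA : {lrmorphism D -> A'}) (iA : {lrmorphism A -> A'}) : Prop :=
  is_tensor_over (fun (x : D) (u : Uh) => x * l u)
                 (fun (u : Uh) (a : A) => jA (m u) * a)
                 (fun (x : D) (a : A) => dA x * iA a).

Definition left_ideal (B : nzRingType) (x : B) : {pred B} :=
  [pred z | `[< exists a, z = a * x >]].

Fact left_ideal_zmod (B : nzRingType) (x : B) : zmod_closed (left_ideal x).
Proof.
split=> [|y z /asboolP[a ->] /asboolP[b ->]]; apply/asboolP.
  by exists 0; rewrite mul0r.
by exists (a - b); rewrite mulrBl.
Qed.

HB.instance Definition _ (B : nzRingType) (x : B) :=
  GRing.isZmodClosed.Build B (left_ideal x) (left_ideal_zmod x).

Definition two_sided_sum (B : nzRingType) (x y : B) : {pred B} :=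
  [pred z | `[< exists a b, z = x * a + b * y >]].

Fact two_sided_sum_zmod (B : nzRingType) (x y : B) :
  zmod_closed (two_sided_sum x y).
Proof.
split=> [|z t /asboolP[a [b ->]] /asboolP[a' [b' ->]]]; apply/asboolP.
  by exists 0, 0; rewrite mulr0 mul0r addr0.
by exists (a - a'), (b - b'); rewrite mulrBr mulrBl opprD addrACA.
Qed.

HB.instance Definition _ (B : nzRingType) (x y : B) :=
  GRing.isZmodClosed.Build B (two_sided_sum x y) (two_sided_sum_zmod x y).

Definition lquot (B : nzRingType) (x : B) : zmodType :=
  {ideal_quot (left_ideal x)}.

Definition lclass (B : nzRingType) (x z : B) : lquot x :=
  \pi_{ideal_quot (left_ideal x)} z.

Definition lrepr (B : nzRingType) (x : B) (u : lquot x) : B :=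
  repr (u : {ideal_quot (left_ideal x)}).

Definition dcoset (B : nzRingType) (x y : B) : zmodType :=
  {ideal_quot (two_sided_sum x y)}.

Definition dclass (B : nzRingType) (x y z : B) : dcoset x y :=
  \pi_{ideal_quot (two_sided_sum x y)} z.

Definition drepr (B : nzRingType) (x y : B) (u : dcoset x y) : B :=
  repr (u : {ideal_quot (two_sided_sum x y)}).

Definition mickelsson (B : nzRingType) (x : B) (u : lquot x) : Prop :=
  exists z, u = lclass x z /\ x * z \in left_ideal x.

(* The product of the Mickelsson algebra; for [v] in that algebra it does not
   depend on the representatives. *)
Definition mickelsson_mul (B : nzRingType) (x : B) (u v : lquot x) : lquot x :=
  lclass x (lrepr u * lrepr v).

(* Sums over [setT : set nat] are sums of finitely many nonzero terms.  In
   the definitions below [e], [f] are the images of e_alpha,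
   e_{-alpha}, and [h] is the image of h_alpha in [D]. *)
Definition extremal_proj (K : fieldType) (A' : algType K)
    (D : comUnitAlgType K) (dA : {lrmorphism D -> A'})
    (e f : A') (h : D) (y : A') : lquot f :=
  \sum_(n \in [set: nat])
    lclass f ((n`!%:R)^-1 *: (dA (\prod_(i < n) (h - (i + 2)%:R))^-1
                              * e ^+ n * f ^+ n * y)).

(* The class of [drepr a * z], for [z] any representative of
   [extremal_proj]; the result does not depend on the representatives. *)
Definition dcoset_mul (K : fieldType) (A' : algType K)
    (D : comUnitAlgType K) (dA : {lrmorphism D -> A'})
    (e f : A') (h : D) (a b : dcoset e f) : dcoset e f :=
  dclass e f (drepr a * lrepr (extremal_proj dA e f h (drepr b))).

Definition zhelobenko_series (K : fieldType) (A A' : algType K)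
    (D : comUnitAlgType K) (dA : {lrmorphism D -> A'})
    (iA : {lrmorphism A -> A'}) (e f : A) (h : D) (x : A) : lquot (iA e) :=
  \sum_(n \in [set: nat])
    lclass (iA e) (((-1) ^+ n / n`!%:R)
      *: (iA (iter n (rcomm e) x) * iA f ^+ n
          * dA (\prod_(i < n) (h - i%:R))^-1)).

(* The Zhelobenko map is the additive map on [A'] determined by its values on
   the products x d with x in [A] and d in [D]; right multiplication by [D]
   preserves the left ideal generated by e_alpha. *)
Definition is_zhelobenko_map (K : fieldType) (A A' : algType K)
    (D : comUnitAlgType K) (dA : {lrmorphism D -> A'})
    (iA : {lrmorphism A -> A'}) (e f : A) (h : D)
    (tau : D -> D) (q : A' -> lquot (iA e)) : Prop :=
  forall (x : A) (c : D),
    q (iA x * dA c) =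
      lclass (iA e)
        (lrepr (zhelobenko_series dA iA e f h x) * dA (tau c)).

Arguments is_zhelobenko_map {K A A' D} dA iA e f h tau q.

(* Main.v *)
Require Import Defs.
From HB Require Import structures.
From mathcomp Require Import all_boot all_order all_algebra.
From mathcomp Require Import boolp classical_sets reals complex.
From mathcomp Require Import cardinality fsbigop.
From mathcomp Require Import generic_quotient ring_quotient.
From mathcomp Require Import zify ring.

Set Implicit Arguments.
Unset Strict Implicit.
Unset Printing Implicit Defensive.

Import Order.TTheory GRing.Theory Num.Theory.
Local Open Scope ring_scope.

(** Write E, F for the images of the two root vectors in the localized algebra
B, c_n = (-1)^n / n!, and M = B / BE, a left B-module. The map q is the member
k = 0 of a family of maps Q_k from B to M; on the image of A,

   Q_k(a) = sum_l  c_l ad_E^l(a) F^(k+l) [h]_(k+l)^-1   mod BE,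

where [h]_n = h (h-1) ... (h-n+1). Three facts about the family give the
theorem.

- Since ad_E is a derivation and c_l is an exponential coefficient, there is
  a Leibniz formula Q_k(bz) = sum_j c_j ad_E^j(b) Q_(k+j)(z), for b in the image
  of A and any z in B ([zshift_Leibniz]).
- E Q_k = k Q_(k-1) ([E_zshift]); so q takes its values in the Mickelsson
  algebra and kills EB. The Leibniz formula for b = F then reads
  Q_k(Fz) = F Q_k(z) - (h+k+2) Q_(k+1)(z) ([zshift_F]).
- Q_k(zF) = 0 ([zshift_FK]).

If Fz lies in BF, the last two facts give Q_(k+1)(z) = (h+k+2)^-1 F Q_k(z),
whence Q_k(z) = F^k [h]_k^-1 q(z) ([zshift_normal]). Substituting this in the
Leibniz formula turns q(bz) into q(b) q(z) ([zhelobenko_mul]). The extremal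
projector replaces any y by such a z, congruent to y modulo EB + BF, where
q vanishes; this is how z enters the product of double cosets
([zhelobenko_hom]).

On B the Q_k are obtained from q, which is given there, by solving the relation
for Q_k(Fz) for Q_(k+1).

The rest verifies that the sums above are finite and that the products a d,
with a in A and d in D, span B.

- Finiteness needs ad e to be locally nilpotent on g for every root vector e of
  a real root ([real_root_ad_nil]). A simple reflection lifts to an automorphism
  of g, the product of three exponentials, so only simple roots matter; their
  root spaces are lines, by the triangular decomposition.
- The denominators h_gamma + k can be moved across a weight vector of weight mu
  because mu(h_gamma) is an integer: h_gamma is an integral combination of
  simple coroots, on which mu is integral by the representation theory of sl_2
  ([V_weight_int], [movable_weight]). *)

(** * Leibniz formulas and local nilpotence *)

Lemma sum_triangle (V : nmodType) (F : nat -> nat -> V) N M :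
  (forall i j, (N <= i)%N || (M <= j)%N -> F i j = 0) ->
  \sum_(n < N + M) \sum_(i < n.+1) F i (n - i)%N =
  \sum_(i < N) \sum_(j < M) F i j.
Proof.
move=> F0.
have tri S : \sum_(n < S) \sum_(i < n.+1) F i (n - i)%N =
             \sum_(i < S) \sum_(j < S - i) F i j.
  elim: S => [|S IHS]; first by rewrite !big_ord0.
  rewrite big_ord_recr /= IHS [RHS]big_ord_recr /= subSnn big_ord1.
  rewrite [X in _ + X]big_ord_recr /= subnn addrA -big_split /=; congr (_ + _).
  by apply: eq_bigr => i _; rewrite subSn 1?ltnW // big_ord_recr.
rewrite tri big_split_ord /= [X in _ + X]big1 ?addr0 => [|i _]; last first.
  by apply: big1 => j _; apply: F0; rewrite leq_addr.
apply: eq_bigr => i _; rewrite -addnBAC ?(ltnW (ltn_ord i)) // addnC big_split_ord /=.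
by rewrite [X in _ + X]big1 ?addr0 // => j _; apply: F0; rewrite leq_addr orbT.
Qed.

Lemma iter_Leibniz (V1 V2 : Type) (V3 : zmodType) (mu : V1 -> V2 -> V3)
    (D1 : V1 -> V1) (D2 : V2 -> V2) (D3 : {additive V3 -> V3}) :
  (forall a b, D3 (mu a b) = mu (D1 a) b + mu a (D2 b)) ->
  forall n a b, iter n D3 (mu a b) =
    \sum_(i < n.+1) mu (iter i D1 a) (iter (n - i) D2 b) *+ 'C(n, i).
Proof.
move=> Dmu n a b; elim: n => [|n IHn].
  by rewrite big_ord1 bin0 subn0.
rewrite iterS IHn raddf_sum /=.
under eq_bigr => i _ do rewrite raddfMn Dmu mulrnDl -!iterS.
rewrite big_split /= [X in X + _]big_ord_recr /= [X in _ + X]big_ord_recl /=.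
rewrite [RHS]big_ord_recl /= [X in _ = _ + X]big_ord_recr /= !binn !bin0 !subn0 !subnn.
rewrite (_ : \sum_(i < n) mu (iter (bump 0 i) D1 a)
                              (iter (n.+1 - bump 0 i) D2 b) *+ 'C(n.+1, bump 0 i) =
  \sum_(i < n) mu (iter i.+1 D1 a) (iter (n - i) D2 b) *+ 'C(n, i) +
  \sum_(i < n) mu (iter (bump 0 i) D1 a)
                 (iter (n - bump 0 i).+1 D2 b) *+ 'C(n, bump 0 i)); last first.
  rewrite -big_split /=; apply: eq_bigr => i _.
  rewrite /bump leq0n add1n binS mulrnDr subSS addrC; congr (_ + _ *+ _).
  by rewrite -(subnSK (ltn_ord i)).
by rewrite [LHS]addrC -[LHS]addrA; congr (_ + _); rewrite addrCA addrA.
Qed.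

Definition expcoef (K : numFieldType) (t : K) n := t ^+ n / n`!%:R.

Lemma expcoef0 (K : numFieldType) (t : K) : expcoef t 0 = 1.
Proof. by rewrite /expcoef expr0 fact0 divr1. Qed.

Lemma expcoef1 (K : numFieldType) (t : K) : expcoef t 1 = t.
Proof. by rewrite /expcoef divr1. Qed.

Lemma expcoef2 (K : numFieldType) (t : K) : expcoef t 2 = t ^+ 2 / 2.
Proof. by []. Qed.

Lemma expcoefS (K : numFieldType) (t : K) n :
  n.+1%:R * expcoef t n.+1 = t * expcoef t n.
Proof.
have hn : n.+1%:R != 0 :> K by rewrite pnatr_eq0.
have hf : n`!%:R != 0 :> K by rewrite pnatr_eq0 -lt0n fact_gt0.
rewrite /expcoef factS natrM exprS.
by move: (n.+1%:R : K) (n`!%:R : K) hn hf => a b a0 b0; field; rewrite a0 b0.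
Qed.

Lemma expcoef_bin (K : numFieldType) (t : K) n i : (i <= n)%N ->
  expcoef t n *+ 'C(n, i) = expcoef t i * expcoef t (n - i).
Proof.
move=> le_in; rewrite /expcoef -(bin_fact le_in) -mulr_natr !natrM.
rewrite -[in t ^+ n](subnKC le_in) exprD.
have nz m : m`!%:R != 0 :> K by rewrite pnatr_eq0 -lt0n fact_gt0.
have nzC : 'C(n, i)%:R != 0 :> K by rewrite pnatr_eq0 -lt0n bin_gt0.
by field; rewrite !nz nzC.
Qed.

(** This is exp(t D3) (mu a b) = mu (exp(t D1) a) (exp(t D2) b), with an
auxiliary family [G] applied to the terms of total degree [n]; the Zhelobenko
series needs [G n] to be the product by a factor that depends on [n]. *)
Lemma exp_Leibniz (K : numFieldType) (V1 V2 : Type) (V3 : lmodType K) (V : lmodType K)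
    (mu : V1 -> V2 -> V3) (D1 : V1 -> V1) (D2 : V2 -> V2)
    (D3 : {additive V3 -> V3}) (G : nat -> V3 -> V) (t : K) :
  (forall n, linear (G n)) ->
  (forall a b, D3 (mu a b) = mu (D1 a) b + mu a (D2 b)) ->
  forall N M a b,
  (forall i j, (N <= i)%N || (M <= j)%N -> mu (iter i D1 a) (iter j D2 b) = 0) ->
  \sum_(n < N + M) expcoef t n *: G n (iter n D3 (mu a b)) =
  \sum_(i < N) \sum_(j < M) (expcoef t i * expcoef t j) *:
     G (i + j)%N (mu (iter i D1 a) (iter j D2 b)).
Proof.
move=> Glin Dmu N M a b mu0.
pose GL n : {linear V3 -> V} := HB.pack (G n) (GRing.isLinear.Build _ _ _ _ (G n) (Glin n)).
have GE n x : G n x = GL n x by [].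
under eq_bigr => n _ do rewrite GE.
under [RHS]eq_bigr => i _ do under eq_bigr => j _ do rewrite GE.
rewrite -(sum_triangle (F := fun i j => (expcoef t i * expcoef t j) *:
   GL (i + j)%N (mu (iter i D1 a) (iter j D2 b)))); last first.
  by move=> i j ij; rewrite mu0 // linear0 scaler0.
apply: eq_bigr => n _; rewrite (iter_Leibniz Dmu) linear_sum scaler_sumr.
apply: eq_bigr => i _; have le_in : (i <= n)%N by rewrite -ltnS.
by rewrite linearMn -scaler_nat scalerA mulr_natr expcoef_bin // subnKC.
Qed.

Lemma iter_additive0 (V : zmodType) (D : {additive V -> V}) n : iter n D 0 = 0.
Proof. by elim: n => //= n ->; rewrite raddf0. Qed.

Lemma iter_nil_le (V : zmodType) (D : {additive V -> V}) n m x :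
  (n <= m)%N -> iter n D x = 0 -> iter m D x = 0.
Proof. by move=> /subnK <- Dx; rewrite iterD Dx iter_additive0. Qed.

Lemma iter_additiveD (V : zmodType) (D : {additive V -> V}) n x y :
  iter n D (x + y) = iter n D x + iter n D y.
Proof. by elim: n => //= n ->; rewrite raddfD. Qed.

Lemma iter_linearZ (K : pzRingType) (V : lmodType K) (D : {linear V -> V}) n c x :
  iter n D (c *: x) = c *: iter n D x.
Proof. by elim: n => //= n ->; rewrite linearZ. Qed.

Definition loc_nil (V : zmodType) (D : V -> V) (x : V) := exists n, iter n D x = 0.

Lemma loc_nil_lin (K : pzRingType) (V : lmodType K) (D : {linear V -> V}) c x y :
  loc_nil D x -> loc_nil D y -> loc_nil D (c *: x + y).
Proof.
move=> [n Dx] [m Dy]; exists (maxn n m).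
rewrite iter_additiveD iter_linearZ.
by rewrite (iter_nil_le (leq_maxl n m) Dx) (iter_nil_le (leq_maxr n m) Dy) scaler0 addr0.
Qed.

Lemma loc_nil_mul (V1 V2 V3 : zmodType) (mu : V1 -> V2 -> V3)
    (D1 : {additive V1 -> V1}) (D2 : {additive V2 -> V2}) (D3 : {additive V3 -> V3}) :
  (forall a b, D3 (mu a b) = mu (D1 a) b + mu a (D2 b)) ->
  (forall b, mu 0 b = 0) -> (forall a, mu a 0 = 0) ->
  forall a b, loc_nil D1 a -> loc_nil D2 b -> loc_nil D3 (mu a b).
Proof.
move=> Dmu mu0l mu0r a b [n Da] [m Db]; exists (n + m)%N.
rewrite (iter_Leibniz Dmu) big1 // => i _.
have [le_ni|lt_in] := leqP n i; first by rewrite (iter_nil_le le_ni Da) mu0l mul0rn.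
by rewrite (iter_nil_le _ Db) ?mu0r ?mul0rn //; lia.
Qed.

Lemma iter_additive_sum (V : zmodType) (D : {additive V -> V}) n I (r : seq I) (F : I -> V) :
  iter n D (\sum_(i <- r) F i) = \sum_(i <- r) iter n D (F i).
Proof.
elim: r => [|i r IHr]; first by rewrite !big_nil iter_additive0.
by rewrite !big_cons iter_additiveD IHr.
Qed.

(** * Induction on enveloping algebras and tensor products *)

(** A universal property yields an induction principle: the structure
factors through the subobject cut out by [P], and by uniqueness the composite
with the inclusion is the identity. *)
Section SubAlgebra.
Variables (K : fieldType) (U : algType K) (P : U -> Prop).
Hypotheses (P1 : P 1) (Plin : forall c x y, P x -> P y -> P (c *: x + y))
  (PM : forall x y, P x -> P y -> P (x * y)).

Definition subalg_pred : {pred U} := [pred x | `[< P x >]].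

Lemma subalg_pred_closed : GRing.subsemialg_closed subalg_pred.
Proof.
have P0 : P 0 by have := Plin (-1) P1 P1; rewrite scaleN1r addNr.
split; first exact/asboolP.
- split=> [|x y /asboolP Px /asboolP Py]; apply/asboolP => //.
  by rewrite -[x]scale1r; apply: Plin.
- by move=> c x /asboolP Px; apply/asboolP; rewrite -[_ *: _]addr0; apply: Plin.
- by move=> x y /asboolP Px /asboolP Py; apply/asboolP; apply: PM.
Qed.

(** The closure proof is a parameter so that the algebra structure, which
depends on it, can be found from the type. *)
Definition subalg_of (_ : GRing.subsemialg_closed subalg_pred) := {x : U | subalg_pred x}.
Notation W := (subalg_of subalg_pred_closed).
HB.instance Definition _ := SubChoice.on W.
HB.instance Definition _ :=
  GRing.SubChoice_isSubAlgebra.Build K U subalg_pred W subalg_pred_closed.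

Definition subalg_val : W -> U := val.
HB.instance Definition _ := GRing.RMorphism.copy subalg_val (val : W -> U).
HB.instance Definition _ := GRing.Linear.copy subalg_val (val : W -> U).

Lemma subalg_valP (w : W) : P (subalg_val w).
Proof. exact/asboolP/(valP w). Qed.

Definition subalg_Sub x (Px : P x) : W := Sub x (asboolT Px).

Lemma subalg_SubK x (Px : P x) : subalg_val (subalg_Sub Px) = x.
Proof. exact: SubK. Qed.

Lemma subalg_val_inj : injective subalg_val.
Proof. exact: val_inj. Qed.

Lemma enveloping_ind_sub (L : lieAlgType K) (i : {linear L -> U}) :
  is_enveloping i -> (forall x, P (i x)) -> forall u, P u.
Proof.
move=> [irep iuniv] Pi u.
pose f x : W := subalg_Sub (Pi x).
have flin : linear f.
  by move=> c x y; apply: subalg_val_inj; rewrite linearP /= !subalg_SubK linearP.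
pose fL : {linear L -> W} := HB.pack f (GRing.isLinear.Build _ _ _ _ f flin).
have frep : lie_rep fL.
  move=> x y; apply: subalg_val_inj.
  by rewrite /rcomm rmorphB !rmorphM /= !subalg_SubK irep.
have [F [Ff _]] := iuniv _ _ frep.
have [G [_ Guniq]] := iuniv _ _ irep.
have -> : u = subalg_val (F u).
  transitivity (G u).
    by apply: (Guniq idfun).
  symmetry; apply: (Guniq (subalg_val \o F : {lrmorphism U -> U})) => x.
  by rewrite /= Ff subalg_SubK.
exact: subalg_valP.
Qed.
End SubAlgebra.

Section SubModule.
Variables (K : fieldType) (T : lmodType K) (P : T -> Prop).
Hypotheses (P0 : P 0) (Plin : forall c x y, P x -> P y -> P (c *: x + y)).

Definition submod_pred : {pred T} := [pred x | `[< P x >]].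

Lemma submod_pred_closed : GRing.subsemimod_closed submod_pred.
Proof.
split.
  split=> [|x y /asboolP Px /asboolP Py]; apply/asboolP => //.
  by rewrite -[x]scale1r; apply: Plin.
by move=> c x /asboolP Px; apply/asboolP; rewrite -[_ *: _]addr0; apply: Plin.
Qed.

Definition submod_of (_ : GRing.subsemimod_closed submod_pred) := {x : T | submod_pred x}.
Notation W := (submod_of submod_pred_closed).
HB.instance Definition _ := SubChoice.on W.
HB.instance Definition _ :=
  GRing.SubChoice_isSubLmodule.Build K T submod_pred W submod_pred_closed.

Lemma tensor_ind B (M N : lmodType K) (ract : M -> B -> M) (lact : B -> N -> N)
    (b : M -> N -> T) : is_tensor_over ract lact b ->
  (forall m n, P (b m n)) -> forall t, P t.
Proof.
move=> [[bl br bb] buniv] Pb t.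
pose f m n : W := Sub (b m n) (asboolT (Pb m n)).
case: (buniv W f) => [|F [Ff _]].
  split.
  - by move=> n c x y; apply: val_inj; rewrite linearP /= bl.
  - by move=> m c x y; apply: val_inj; rewrite linearP /= br.
  - by move=> m c n; apply: val_inj; rewrite /= bb.
case: (buniv T b) => [|G [_ Guniq]]; first by split.
have -> : t = val (F t).
  transitivity (G t).
    by apply: (Guniq idfun).
  symmetry; apply: (Guniq (val \o F : {linear T -> T})) => m n.
  by rewrite /= Ff SubK.
exact/asboolP/(valP (F t)).
Qed.
End SubModule.

Lemma enveloping_ind (K : fieldType) (L : lieAlgType K) (U : algType K)
    (i : {linear L -> U}) (P : U -> Prop) : is_enveloping i ->
  P 1 -> (forall c x y, P x -> P y -> P (c *: x + y)) ->
  (forall x y, P x -> P y -> P (x * y)) -> (forall x, P (i x)) -> forall u, P u.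
Proof. by move=> iP P1 Plin PM; apply: enveloping_ind_sub P1 Plin PM _ _ iP. Qed.

(** * Exponentials of nilpotent adjoint actions *)

Section LieBasics.
Variables (K : numFieldType) (L : lieAlgType K).
Implicit Types x y z : L.

HB.instance Definition _ x := GRing.isLinear.Build K L L _ (lie x) (lie_linearr x).

Lemma lie_addl x y z : lie (x + y) z = lie x z + lie y z.
Proof. by have := lie_linearl z 1 x y; rewrite !scale1r. Qed.

Lemma lie0l z : lie 0 z = 0.
Proof. by apply: (addrI (lie 0 z)); rewrite -lie_addl !addr0. Qed.

Lemma lie_scalel c x z : lie (c *: x) z = c *: lie x z.
Proof. by have := lie_linearl z c x 0; rewrite !addr0 lie0l addr0. Qed.

Lemma lie_anti x y : lie x y = - lie y x.
Proof.
apply/eqP; rewrite -addr_eq0; apply/eqP.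
by have := liexx (x + y); rewrite lie_addl !linearD /= !liexx add0r addr0.
Qed.

Lemma lie_der x y z : lie x (lie y z) = lie (lie x y) z + lie y (lie x z).
Proof.
have /eqP := lie_jacobi x y z; rewrite -addrA addr_eq0 => /eqP ->.
by rewrite opprD addrC (lie_anti z (lie x y)) opprK (lie_anti z x) linearN /= opprK.
Qed.

Definition ad_nil x := forall y, loc_nil (lie x) y.

Definition ad_index x (xn : ad_nil x) y : nat := projT1 (cid (xn y)).

Definition ad_exp x (xn : ad_nil x) y : L :=
  \sum_(n < ad_index xn y) expcoef 1 n *: iter n (lie x) y.

Lemma ad_expE x (xn : ad_nil x) y N : iter N (lie x) y = 0 ->
  ad_exp xn y = \sum_(n < N) expcoef 1 n *: iter n (lie x) y.
Proof.
have st M M' : (M <= M')%N -> iter M (lie x) y = 0 ->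
    \sum_(n < M') expcoef 1 n *: iter n (lie x) y =
    \sum_(n < M) expcoef (1 : K) n *: iter n (lie x) y.
  move=> /subnKC <- yM; rewrite big_split_ord /= [X in _ + X]big1 ?addr0 // => i _.
  by rewrite (iter_nil_le (leq_addr i M) yM) scaler0.
move=> yN; rewrite /ad_exp /ad_index; case: cid => M yM /=.
by case: (leqP M N) => [/st -> //|/ltnW /st ->].
Qed.

Lemma ad_exp_linear x (xn : ad_nil x) : linear (ad_exp xn).
Proof.
move=> c y z; have [n yn] := xn y; have [m zm] := xn z.
have yn' := iter_nil_le (leq_maxl n m) yn; have zm' := iter_nil_le (leq_maxr n m) zm.
rewrite (ad_expE _ yn') (ad_expE _ zm') (ad_expE _ (N := maxn n m)); last first.
  by rewrite iter_additiveD iter_linearZ yn' zm' scaler0 addr0.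
rewrite scaler_sumr -big_split /=; apply: eq_bigr => i _.
by rewrite iter_additiveD iter_linearZ scalerDr !scalerA mulrC.
Qed.

HB.instance Definition _ x (xn : ad_nil x) :=
  GRing.isLinear.Build K L L _ (ad_exp xn) (ad_exp_linear xn).

Lemma ad_exp_lie x (xn : ad_nil x) y z :
  ad_exp xn (lie y z) = lie (ad_exp xn y) (ad_exp xn z).
Proof.
have [n yn] := xn y; have [m zm] := xn z.
have mu0 i j : (n <= i)%N || (m <= j)%N -> lie (iter i (lie x) y) (iter j (lie x) z) = 0.
  by case/orP => [le|le]; [rewrite (iter_nil_le le yn) lie0l
                          | rewrite (iter_nil_le le zm) linear0].
rewrite (ad_expE _ (N := (n + m)%N)); last first.
  rewrite (iter_Leibniz (mu := fun y z => lie y z) (lie_der x)) big1 // => i _.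
  by rewrite mu0 ?mul0rn //; case: (leqP n i) => //= lt; lia.
rewrite (ad_expE xn yn) (ad_expE xn zm).
rewrite (exp_Leibniz (mu := fun y z => lie y z) (G := fun=> idfun) 1 _ (lie_der x) mu0) //.
rewrite -[lie (\sum_(i < n) _) _]opprK -lie_anti linear_sum -sumrN; apply: eq_bigr => i _.
rewrite -lie_anti linear_sum; apply: eq_bigr => j _.
by rewrite /= lie_scalel linearZ scalerA.
Qed.

(** The lowest term of the exponential is the identity: if N is the least
exponent with ad_x^N y = 0, then ad_x^(N-1) maps the exponential of [y] to
ad_x^(N-1) y. *)
Lemma ad_exp_inj x (xn : ad_nil x) y : ad_exp xn y = 0 -> y = 0.
Proof.
have [N] := xn y; elim: N => // N IHN yN y0; apply: IHN => //.
have /(congr1 (iter N (lie x))) := y0; rewrite iter_additive0.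
rewrite (ad_expE _ yN) big_ord_recl /= expcoef0 scale1r iter_additiveD.
rewrite iter_additive_sum big1 ?addr0 // => i _.
rewrite iter_linearZ -iterS -iterD (iter_nil_le _ yN) ?scaler0 //.
by rewrite /bump /= addnS ltnS leq_addr.
Qed.
End LieBasics.

(** * Reflections and local nilpotence of simple root vectors *)

Section Contragredient.
Variables (K : numFieldType) (g : contragredient K).
Notation n := (rk g).
Notation a := (cmat g).

Lemma lie_subalg_ad_nil (x : g) :
  lie_subalgebra (fun y => loc_nil (lie x) y).
Proof.
split.
- by exists 0.
- by move=> c y z; apply: loc_nil_lin.
- move=> y z.
  apply: (loc_nil_mul (mu := fun y z => lie y z) (lie_der x) (@lie0l _ _)).
  by move=> t; rewrite linear0.
Qed.

Lemma lie_eh (h : cartan g) i : lie (chev_e i) (inc g h) = - (sroot i h : K) *: chev_e i.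
Proof. by rewrite lie_anti lie_he scaleNr. Qed.

Lemma lie_fh (h : cartan g) i : lie (chev_f i) (inc g h) = (sroot i h : K) *: chev_f i.
Proof. by rewrite lie_anti lie_hf scaleNr opprK. Qed.

Lemma lie_fe (i j : 'I_n) : lie (chev_f i) (chev_e j) = if i == j then - inc g (coroot i) else 0.
Proof. by rewrite lie_anti lie_ef eq_sym; case: eqP => [->|]; rewrite ?oppr0. Qed.

Lemma sroot_coroot_ii (i : 'I_n) : (sroot i (coroot i) : K) = 2.
Proof. by rewrite sroot_coroot; case: (cmat_gcm g) => -> _ _. Qed.

(** The elements on which a given adjoint action is locally nilpotent form a
subalgebra; it contains the Chevalley generators by the Serre relations. *)
Lemma chev_e_nil (i : 'I_n) : ad_nil (chev_e i).
Proof.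
apply: (chev_gen (lie_subalg_ad_nil _)).
- by move=> h; exists 2%N; rewrite /= lie_eh linearZ /= liexx scaler0.
- move=> j; case: (eqVneq i j) => [->|ij]; first by exists 1%N; rewrite /= liexx.
  by exists `|1 - a i j|%N; apply: serre_e.
- move=> j; exists 3%N; rewrite /= lie_ef; case: eqP => _; last by rewrite !linear0.
  by rewrite lie_eh linearZ /= liexx scaler0.
Qed.

Lemma chev_f_nil (i : 'I_n) : ad_nil (chev_f i).
Proof.
apply: (chev_gen (lie_subalg_ad_nil _)).
- by move=> h; exists 2%N; rewrite /= lie_fh linearZ /= liexx scaler0.
- move=> j; exists 3%N; rewrite /= lie_fe; case: eqP => _; last by rewrite !linear0.
  by rewrite linearN /= lie_fh linearN linearZ /= liexx scaler0 oppr0.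
- move=> j; case: (eqVneq i j) => [->|ij]; first by exists 1%N; rewrite /= liexx.
  by exists `|1 - a i j|%N; apply: serre_f.
Qed.

Lemma ad_nil_scale k (x : g) : ad_nil x -> ad_nil (k *: x).
Proof.
move=> xn y; have [N xN] := xn y; exists N.
suff -> : iter N (lie (k *: x)) y = k ^+ N *: iter N (lie x) y by rewrite xN scaler0.
elim: N {xN} => [|N IHN] /=; first by rewrite scale1r.
by rewrite IHN linearZ /= lie_scalel scalerA exprSr.
Qed.

Lemma ad_nil_opp (x : g) : ad_nil x -> ad_nil (- x).
Proof. by rewrite -scaleN1r; apply: ad_nil_scale. Qed.

Definition coreflection (i : 'I_n) (h : cartan g) : cartan g := h - (sroot i h : K) *: coroot i.

(** The lift of a simple reflection to an automorphism of the Lie algebra: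
exp(ad f) exp(- ad e) exp(ad f). *)
Definition reflection_lift i (x : g) : g :=
  ad_exp (chev_f_nil i) (ad_exp (ad_nil_opp (chev_e_nil i)) (ad_exp (chev_f_nil i) x)).

Lemma reflection_lift_linear i : linear (reflection_lift i).
Proof. by move=> c x y; rewrite /reflection_lift !linearP. Qed.

HB.instance Definition _ i :=
  GRing.isLinear.Build K g g _ (reflection_lift i) (reflection_lift_linear i).

Lemma reflection_lift_lie i (x y : g) :
  reflection_lift i (lie x y) = lie (reflection_lift i x) (reflection_lift i y).
Proof. by rewrite /reflection_lift !ad_exp_lie. Qed.

Lemma reflection_lift_inj i x : reflection_lift i x = 0 -> x = 0.
Proof. by move=> /ad_exp_inj/ad_exp_inj/ad_exp_inj. Qed.

Lemma reflection_lift_inc i h : reflection_lift i (inc g h) = inc g (coreflection i h).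
Proof.
set e := chev_e i; set f := chev_f i; set c := (sroot i h : K).
have fh h' : ad_exp (chev_f_nil i) (inc g h') = inc g h' + (sroot i h' : K) *: f.
  rewrite (ad_expE _ (N := 2)); last by rewrite /= lie_fh linearZ /= liexx scaler0.
  by rewrite !big_ord_recl big_ord0 /= expcoef0 expcoef1 !scale1r addr0 lie_fh.
have ff : ad_exp (chev_f_nil i) f = f.
  rewrite (ad_expE _ (N := 1)); last by rewrite /= liexx.
  by rewrite big_ord1 /= expcoef0 scale1r.
have eh : ad_exp (ad_nil_opp (chev_e_nil i)) (inc g h) = inc g h + c *: e.
  have E : lie (- chev_e i) (inc g h) = c *: e.
    by rewrite -scaleN1r lie_scalel lie_eh scalerA mulN1r opprK.
  rewrite (ad_expE _ (N := 2)); last first.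
    by rewrite /= E linearZ /= -scaleN1r lie_scalel liexx !scaler0.
  by rewrite !big_ord_recl big_ord0 /= expcoef0 expcoef1 !scale1r addr0 E.
have ee : ad_exp (ad_nil_opp (chev_e_nil i)) f = f - inc g (coroot i) - e.
  have E1 : lie (- chev_e i) f = - inc g (coroot i).
    by rewrite -scaleN1r lie_scalel lie_ef eqxx scaleN1r.
  have E2 : lie (- chev_e i) (- inc g (coroot i)) = - (2 *: e).
    rewrite -[- inc g _]scaleN1r linearZ /= -scaleN1r lie_scalel lie_eh sroot_coroot_ii.
    by rewrite !scalerA -scaleNr; congr (_ *: _); ring.
  rewrite (ad_expE _ (N := 3)); last first.
    by rewrite /= E1 E2 -scaleNr linearZ /= -scaleN1r lie_scalel liexx !scaler0.
  rewrite !big_ord_recl big_ord0 /= expcoef0 expcoef1 expcoef2 expr1n mul1r !scale1r addr0 E1 E2.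
  by rewrite -scaleNr scalerA mulrN mulVf ?pnatr_eq0 // scaleN1r addrA.
rewrite /reflection_lift fh linearD linearZ /= eh ee -/c !scalerBr addrA.
rewrite [inc g h + _ + _]addrAC addrK addrA linearB linearD !linearZ /= !fh ff -/c.
rewrite sroot_coroot_ii /coreflection linearB linearZ /= -/c scalerN scalerDr scalerA.
have -> : c * 2 = c + c by ring.
by rewrite -[_ + _ + c *: f]addrA -scalerDl opprD addrACA subrr addr0.
Qed.
End Contragredient.

Section Roots.
Variables (K : numFieldType) (g : contragredient K).
Notation n := (rk g).
Notation a := (cmat g).
Implicit Types (c : 'rV[int]_n) (h : cartan g).

Lemma weightZl c k h : weight c (k *: h) = k * weight c h.
Proof.
rewrite /weight mulr_sumr; apply: eq_bigr => i _.
by rewrite linearZ /= mulrCA.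
Qed.

Lemma weightB c h h' : weight c (h - h') = weight c h - weight c h'.
Proof.
by rewrite /weight -sumrB; apply: eq_bigr => i _; rewrite linearB /= mulrBr.
Qed.

Lemma weight_sum c I (r : seq I) (F : I -> cartan g) :
  weight c (\sum_(i <- r) F i) = \sum_(i <- r) weight c (F i).
Proof.
rewrite /weight exchange_big; apply: eq_bigr => i _.
by rewrite linear_sum /= mulr_sumr.
Qed.

Lemma weight_coroot c i : weight c (coroot i) = (\sum_j a i j * c 0 j)%:~R.
Proof.
rewrite /weight rmorph_sum; apply: eq_bigr => j _ /=.
by rewrite sroot_coroot mulrC intrM.
Qed.

Lemma weight_delta i h : weight (delta_mx 0 i) h = sroot i h.
Proof.
rewrite /weight (bigD1 i) //= mxE !eqxx mul1r big1 ?addr0 // => j ji.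
by rewrite mxE eqxx (negbTE ji) mul0r.
Qed.

Lemma weight_reflection i c h :
  weight (simple_reflection a i c) h = weight c (coreflection i h).
Proof.
rewrite /coreflection weightB weightZl weight_coroot.
rewrite /weight /simple_reflection; set k := \sum_j a i j * c 0 j.
under eq_bigr => j _ do rewrite !mxE eqxx /= intrB intrM mulrBl.
rewrite sumrB; congr (_ - _); rewrite (bigD1 i) //= eqxx mulr1 big1 ?addr0 1?mulrC // => j ji.
by rewrite (negbTE ji) mulr0 mul0r.
Qed.

Lemma coreflectionK (i : 'I_n) : involutive (@coreflection K g i).
Proof.
move=> h; have Ei : (sroot i (coreflection i h) : K) = - (sroot i h : K).
  rewrite /coreflection linearB linearZ /= sroot_coroot_ii /GRing.scale /=.
  by ring.
by rewrite {1}/coreflection Ei scaleNr opprK subrK.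
Qed.

Lemma root_space_reflection_lift i c (x : g) :
  root_space (simple_reflection a i c) x -> root_space c (reflection_lift i x).
Proof.
move=> xc h; rewrite -[h in inc g h](coreflectionK i) -reflection_lift_inc.
by rewrite -reflection_lift_lie xc linearZ /= weight_reflection coreflectionK.
Qed.

(** The lifted reflection is an injective morphism that carries the root space
of s_i(c) into that of c, so nilpotence can be pulled back along it. *)
Lemma ad_nil_reflection i c :
  (forall x : g, root_space c x -> ad_nil x) ->
  forall x : g, root_space (simple_reflection a i c) x -> ad_nil x.
Proof.
move=> IH x /root_space_reflection_lift/IH xn y.
have [N yN] := xn (reflection_lift i y); exists N.
apply: (reflection_lift_inj (i := i)); rewrite -[RHS]yN.
by elim: N {yN} => //= N <-; rewrite reflection_lift_lie.
Qed.

Lemma simple_reflectionN i c : simple_reflection a i (- c) = - simple_reflection a i c.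
Proof.
rewrite /simple_reflection (eq_bigr (fun j => - (a i j * c 0 j))) => [|j _].
  by rewrite sumrN scaleNr opprB opprK addrC.
by rewrite mxE mulrN.
Qed.

Lemma simple_reflection_delta i :
  simple_reflection a i (delta_mx 0 i) = - delta_mx 0 i.
Proof.
rewrite /simple_reflection (bigD1 i) //= big1 ?addr0 => [|j ji]; last first.
  by rewrite mxE eqxx (negbTE ji) mulr0.
case: (cmat_gcm g) => -> _ _; rewrite mxE !eqxx /=.
by rewrite mulr1 mulr2n scalerDl scale1r opprD addNKr.
Qed.

Lemma real_rootN c : real_root (g := g) c -> real_root (g := g) (- c).
Proof.
move=> [w [i ->]]; exists (rcons w i), i.
rewrite foldr_rcons simple_reflection_delta.
by elim: w => //= j w <-; rewrite simple_reflectionN.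
Qed.

Lemma sroot_surj (v : 'I_n -> K) : exists h : cartan g, forall i, sroot i h = v i.
Proof.
pose b := vbasis {:cartan g}.
pose M : 'M[K]_(n, \dim {:cartan g}) := \matrix_(i, j) (sroot i b`_j : K).
have bP : basis_of {:cartan g} b := vbasisP _.
have Mfree : row_free M.
  apply/inj_row_free => u uM.
  have u0 : \sum_i u 0 i *: (sroot i : 'Hom(cartan g, K^o)) = 0.
    apply/lfunP => h; rewrite zero_lfunE.
    rewrite (coord_basis bP (memvf h)) linear_sum big1 //= => j _.
    rewrite linearZ /= sum_lfunE.
    have /rowP/(_ j) := uM; rewrite !mxE => uMj.
    rewrite (eq_bigr (fun i => u 0 i * M i j)) ?uMj ?scaler0 // => i _.
    by rewrite scale_lfunE mxE.
  have fr : free [tuple (sroot i : 'Hom(cartan g, K^o)) | i < n].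
    by have := sroot_free g; rewrite /image_mem -val_ord_tuple.
  apply/rowP => i; rewrite mxE; apply: (freeP fr) => //.
  by rewrite -[RHS]u0; apply: eq_bigr => j _; rewrite -tnth_nth tnth_mktuple.
have [N MN] := row_freeP Mfree.
exists (\sum_j (\sum_k N j k * v k) *: b`_j) => i.
transitivity (\sum_k (M *m N) i k * v k).
  rewrite linear_sum /=; under [RHS]eq_bigr => k _ do rewrite mxE mulr_suml.
  rewrite exchange_big /=; apply: eq_bigr => j _.
  rewrite linearZ /= /GRing.scale /= mulr_suml; apply: eq_bigr => k _.
  by rewrite mxE; ring.
rewrite MN (bigD1 i) //= mxE eqxx mul1r big1 ?addr0 // => k ki.
by rewrite mxE eq_sym (negbTE ki) mul0r.
Qed.
End Roots.

(** * Triangular decomposition and simple root spaces *)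

Inductive lspan (K : pzRingType) (V : lmodType K) (S : V -> Prop) : V -> Prop :=
| lspan0 : lspan S 0
| lspan_cons k x y : S x -> lspan S y -> lspan S (k *: x + y).

Section LSpan.
Variables (K : pzRingType) (V : lmodType K).
Implicit Types S : V -> Prop.

Lemma lspan_lin S k x y : lspan S x -> lspan S y -> lspan S (k *: x + y).
Proof.
move=> Sx Sy; elim: Sx => [|k' x' y' Sx' _ IH]; first by rewrite scaler0 add0r.
by rewrite scalerDr scalerA -addrA; apply: lspan_cons.
Qed.

Lemma lspan_gen S x : S x -> lspan S x.
Proof.
move=> Sx; rewrite -[x]scale1r -[_ *: _]addr0.
by apply: lspan_cons => //; apply: lspan0.
Qed.

Lemma lspanD S x y : lspan S x -> lspan S y -> lspan S (x + y).
Proof. by rewrite -{2}[x]scale1r; apply: lspan_lin. Qed.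

Lemma lspanZ S k x : lspan S x -> lspan S (k *: x).
Proof. by move=> Sx; rewrite -[_ *: _]addr0; apply: lspan_lin => //; apply: lspan0. Qed.

Lemma lspan_linear S S' (T : {linear V -> V}) :
  (forall x, S x -> lspan S' (T x)) -> forall x, lspan S x -> lspan S' (T x).
Proof.
move=> ST x; elim=> [|k {}x y Sx _ IH]; first by rewrite linear0; apply: lspan0.
by rewrite linearP; apply: lspan_lin => //; apply: ST.
Qed.
End LSpan.

Section Words.
Variables (K : numFieldType) (g : contragredient K).
Notation n := (rk g).

Definition lie_word (x : 'I_n -> g) (s : seq 'I_n) (i : 'I_n) : g :=
  foldr (fun j y => lie (x j) y) (x i) s.

Definition word_weight (s : seq 'I_n) (i : 'I_n) (h : cartan g) : K :=
  \sum_(j <- rcons s i) (sroot j h : K).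

Section OneSide.
(* ([x], [y], [eps]) is (e, f, 1) or (f, e, -1); this treats the two nilpotent
   halves of the algebra at once. *)
Variables (x y : 'I_n -> g) (eps : K).
Hypotheses (hx : forall h i, lie (inc g h) (x i) = (eps * (sroot i h : K)) *: x i)
  (yx : forall i j, lie (y i) (x j) = if i == j then (- eps) *: inc g (coroot i) else 0).

Lemma lie_inc_word h s i :
  lie (inc g h) (lie_word x s i) = (eps * word_weight s i h) *: lie_word x s i.
Proof.
elim: s => [|j s IHs] /=; first by rewrite hx /word_weight big_seq1.
rewrite lie_der hx IHs linearZ lie_scalel -scalerDl -mulrDr.
by rewrite /word_weight rcons_cons big_cons.
Qed.

Definition is_word (z : g) := exists s i, z = lie_word x s i.
Definition is_cartan (z : g) := exists h, z = inc g h.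

Lemma lspan_word_lie i z :
  lspan (fun z => is_cartan z \/ is_word z) z -> lspan is_word (lie (x i) z).
Proof.
apply: (@lspan_linear _ _ _ _ (lie (x i))) => _ [[h ->]|[s [j ->]]] /=.
  rewrite lie_anti hx -scaleNr; apply/lspanZ/lspan_gen.
  by exists [::], i.
by apply: lspan_gen; exists (i :: s), j.
Qed.

(** Bracketing a word with an opposite generator removes a letter or, for
a word of one letter, produces a coroot. *)
Lemma lspan_word_lie_opp j s i :
  lspan (fun z => is_cartan z \/ is_word z) (lie (y j) (lie_word x s i)).
Proof.
elim: s => [|k s IHs] /=.
  rewrite yx; case: ifP => _; last exact: lspan0.
  by apply/lspanZ/lspan_gen; left; exists (coroot j).
rewrite lie_der yx; apply: lspanD.
  case: ifP => _; last by rewrite lie0l; apply: lspan0.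
  rewrite lie_scalel lie_inc_word; do 2!apply: lspanZ.
  by apply: lspan_gen; right; exists s, i.
have := lspan_word_lie k IHs.
apply: (@lspan_linear _ _ _ _ idfun) => z Sz; apply: lspan_gen; by right.
Qed.
End OneSide.
End Words.

Section Triangular.
Variables (K : numFieldType) (g : contragredient K).
Notation n := (rk g).
Notation ee := (fun i : 'I_n => chev_e i).
Notation ff := (fun i : 'I_n => chev_f i).

Definition triang (z : g) := [\/ is_cartan z, is_word ee z | is_word ff z].

Lemma lie_he1 (h : cartan g) i :
  lie (inc g h) (chev_e i) = (1 * (sroot i h : K)) *: chev_e i.
Proof. by rewrite mul1r lie_he. Qed.

Lemma lie_hf1 (h : cartan g) i :
  lie (inc g h) (chev_f i) = (-1 * (sroot i h : K)) *: chev_f i.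
Proof. by rewrite mulN1r lie_hf. Qed.

Lemma lie_fe1 (i j : 'I_n) :
  lie (chev_f i) (chev_e j) = if i == j then (- 1) *: inc g (coroot i) else 0.
Proof. by rewrite scaleN1r lie_fe. Qed.

Lemma lie_ef1 (i j : 'I_n) :
  lie (chev_e i) (chev_f j) = if i == j then (- -1) *: inc g (coroot i) else 0.
Proof. by rewrite opprK scale1r lie_ef. Qed.

Lemma lspanS (S S' : g -> Prop) :
  (forall z, S z -> S' z) -> forall z, lspan S z -> lspan S' z.
Proof.
by move=> SS'; apply: (@lspan_linear _ _ _ _ idfun) => z Sz; apply/lspan_gen/SS'.
Qed.

(** The span of the Cartan subalgebra and of the words is stable under the
bracket with each generator, hence under the adjoint action of everything. *)
Lemma triangular (z : g) : lspan triang z.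
Proof.
pose Q z := lspan triang z /\ forall t, lspan triang t -> lspan triang (lie z t).
suff: Q z by case.
have Qgen w : lspan triang w -> (forall t, triang t -> lspan triang (lie w t)) -> Q w.
  by move=> Sw tw; split=> // t; apply: (@lspan_linear _ _ _ _ (lie w)).
move: z; apply: chev_gen.
- split.
  + by split=> [|t _]; rewrite ?lie0l; apply: lspan0.
  + move=> c x y [Sx Qx] [Sy Qy]; split; first exact: lspan_lin.
    by move=> t St; rewrite lie_addl lie_scalel; apply: lspan_lin; [apply: Qx | apply: Qy].
  + move=> x y [Sx Qx] [Sy Qy]; split; first exact: Qx.
    move=> t St; rewrite (_ : lie (lie x y) t = lie x (lie y t) - lie y (lie x t)); last first.
      by rewrite lie_der addrK.
    rewrite -scaleN1r addrC; apply: lspan_lin; first exact/Qy/Qx.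
    exact/Qx/Qy.
- move=> h; apply: Qgen; first by apply: lspan_gen; constructor 1; exists h.
  move=> _ [[h' ->]|[s [i ->]]|[s [i ->]]].
  + by rewrite lie_hh; apply: lspan0.
  + by rewrite (lie_inc_word lie_he1); apply/lspanZ/lspan_gen; constructor 2; exists s, i.
  + by rewrite (lie_inc_word lie_hf1); apply/lspanZ/lspan_gen; constructor 3; exists s, i.
- move=> i; apply: Qgen; first by apply: lspan_gen; constructor 2; exists [::], i.
  move=> _ [[h' ->]|[s [j ->]]|[s [j ->]]].
  + by rewrite lie_eh; apply/lspanZ/lspan_gen; constructor 2; exists [::], i.
  + by apply/lspan_gen; constructor 2; exists (i :: s), j.
  + apply: lspanS (lspan_word_lie_opp lie_hf1 lie_ef1 i s j) => t [tc|tw].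
      by constructor 1.
    by constructor 3.
- move=> i; apply: Qgen; first by apply: lspan_gen; constructor 3; exists [::], i.
  move=> _ [[h' ->]|[s [j ->]]|[s [j ->]]].
  + by rewrite lie_fh; apply/lspanZ/lspan_gen; constructor 3; exists [::], i.
  + apply: lspanS (lspan_word_lie_opp lie_he1 lie_fe1 i s j) => t [tc|tw].
      by constructor 1.
    by constructor 2.
  + by apply/lspan_gen; constructor 3; exists (i :: s), j.
Qed.
End Triangular.

Section Eigen.
Variables (K : fieldType) (V : lmodType K) (T : {linear V -> V}) (mu : K).

Definition other_eigen (y : V) := exists2 l, l != mu & T y = l *: y.

Let op (s : seq K) (z : V) := foldr (fun l y => T y - l *: y) z s.

(** Eigenvectors of [T] for other eigenvalues are killed by a product of factors
T - l with l different from [mu], and such a product acts on the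
[mu]-eigenspace as a nonzero scalar. *)
Lemma eigen_lspan0 r : lspan other_eigen r -> T r = mu *: r -> r = 0.
Proof.
have op_lin s : linear (op s).
  move=> k y z; elim: s => //= l s ->; rewrite linearP /= scalerDr opprD scalerBr.
  by rewrite !scalerA [l * k]mulrC addrACA.
have opC s l z : op s (T z - l *: z) = T (op s z) - l *: op s z.
  elim: s => //= m s ->; rewrite !linearB !linearZ /= !scalerA mulrC.
  by rewrite addrACA.
move=> Sr Tr.
have [s smu s0] : exists2 s, mu \notin s & op s r = 0.
  elim: Sr => [|k y {Tr}r [l lmu Ty] _ [s smu IH]]; first by exists [::].
  exists (l :: s); first by rewrite inE negb_or eq_sym lmu.
  rewrite /= -opC linearP /= scalerDr scalerA mulrC -scalerA -Ty opprD addrACA -scalerBr.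
  by rewrite subrr scaler0 add0r opC IH linear0 scaler0 subr0.
have : op s r = (\prod_(l <- s) (mu - l)) *: r.
  elim: s {smu s0} => [|l s IH] /=; first by rewrite big_nil scale1r.
  by rewrite IH big_cons linearZ /= Tr !scalerA -scalerBl; congr (_ *: _); ring.
rewrite s0 => /esym/eqP; rewrite scaler_eq0 => /orP[|/eqP //].
rewrite prodf_seq_eq0 => /hasP[l ls]; rewrite subr_eq0 /= => /eqP mul.
by rewrite mul ls in smu.
Qed.
End Eigen.

Section SimpleRoot.
Variables (K : numFieldType) (g : contragredient K).
Notation n := (rk g).

(** A Cartan element on which alpha_i takes the value 1 and the other simple
roots the value 2 separates e_i from the rest of the triangular decomposition:
every other word has an eigenvalue at least 2 or at most -1. *)
Lemma simple_root_space (i : 'I_n) (x : g) :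
  root_space (delta_mx 0 i) x -> exists k : K, x = k *: chev_e i.
Proof.
move=> xi; have [h0 h0P] := sroot_surj (g := g) (fun j => if j == i then 1 else 2).
pose T : {linear g -> g} := lie (inc g h0).
have Te : T (chev_e i) = 1 *: chev_e i by rewrite /T /= lie_he h0P eqxx.
have Tx : T x = 1 *: x by rewrite /T /= xi weight_delta h0P eqxx.
have w1 s j : 1 <= word_weight (g := g) s j h0 ?= iff ((s == [::]) && (j == i)).
  have v1 k : 1 <= (sroot k h0 : K) by rewrite h0P; case: ifP => // _; rewrite ler1n.
  rewrite /word_weight; case: s => [|k s].
    rewrite big_seq1 h0P; case: ifP => _; split=> //; rewrite ?eqxx ?ler1n //.
    by rewrite -[1]/(1%:R) eqr_nat.
  have lt1 : 1 < \sum_(l <- rcons (k :: s) j) (sroot l h0 : K).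
    rewrite -cats1 big_cat big_cons big_seq1 /=.
    apply: (@lt_le_trans _ _ (1 + 0 + 1)); first by rewrite addr0 ltrDl ltr01.
    apply: lerD => //; apply: lerD => //; apply: sumr_ge0 => l _.
    exact: le_trans ler01 (v1 l).
  by split; [apply: ltW | apply/negbTE; rewrite lt_eqF].
have dec z : lspan (@triang K g) z ->
    exists k r, z = k *: chev_e i + r /\ lspan (other_eigen T 1) r.
  elim=> [|k {x xi Tx}x y tx _ [k' [r [-> Sr]]]].
    by exists 0, 0; rewrite scale0r addr0; split=> //; apply: lspan0.
  have other : other_eigen T 1 x ->
      exists k0 r0, k *: x + (k' *: chev_e i + r) = k0 *: chev_e i + r0 /\
        lspan (other_eigen T 1) r0.
    move=> xo; exists k', (k *: x + r); split; first by rewrite addrCA.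
    exact: lspan_cons.
  case: tx other => [[h ->]|[s [j ->]]|[s [j ->]]] other.
  - by apply: other; exists 0; rewrite ?scale0r; [rewrite eq_sym oner_neq0 | apply: lie_hh].
  - have [w_ge w_eq] := w1 s j.
    case: (boolP ((s == [::]) && (j == i))) => [/andP[/eqP -> /eqP ->]|ne].
      by exists (k + k'), r; rewrite scalerDl addrA.
    apply: other; exists (word_weight (g := g) s j h0); last first.
      by rewrite /T /= (lie_inc_word (@lie_he1 K g)) mul1r.
    by rewrite eq_sym w_eq (negbTE ne).
  - have [w_ge _] := w1 s j.
    apply: other; exists (- word_weight (g := g) s j h0); last first.
      by rewrite /T /= (lie_inc_word (@lie_hf1 K g)) mulN1r.
    rewrite lt_eqF //; apply: (@lt_le_trans _ _ 0); last exact: ler01.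
    by rewrite oppr_lt0; apply: lt_le_trans w_ge.
have [k [r [xE Sr]]] := dec x (triangular x).
exists k; rewrite xE (eigen_lspan0 Sr) ?addr0 // (_ : r = x - k *: chev_e i).
  by rewrite linearB linearZ /= Tx Te scale1r scalerBr !scale1r.
by rewrite xE addrC addKr.
Qed.

Lemma real_root_ad_nil c (x : g) : real_root (g := g) c -> root_space c x -> ad_nil x.
Proof.
move=> [w [i ->]]; elim: w x => /= [|j w IHw] x.
  by move=> /simple_root_space[k ->]; apply/ad_nil_scale/chev_e_nil.
by apply: ad_nil_reflection => y; apply: IHw.
Qed.
End SimpleRoot.

(** * Coroots of real roots *)

Section RootForm.
Variables (n : nat) (a : 'M[int]_n) (d : 'I_n -> nat).
Hypotheses (a2 : forall i, a i i = 2) (d_sym : symmetrizer a d).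
Implicit Types c : 'rV[int]_n.

(** For gamma in the orbit of alpha_i, (gamma, gamma) = 2 d_i, and the
coroot 2 t_gamma / (gamma, gamma) has the integral coordinates [z] in the basis
of simple coroots. Both are preserved by simple reflections. *)
Lemma root_form_real (w : seq 'I_n) (i : 'I_n) :
  let c := foldr (simple_reflection a) (delta_mx 0 i) w in
  root_form a d c c = 2 * (d i)%:R /\
  exists z : 'I_n -> int, forall k, c 0 k * (d k)%:R = (d i)%:R * z k.
Proof.
have [_ sym] := d_sym.
elim: w => [|j w [IHf [z IHz]]] /=.
  split; last first.
    exists (fun k => (k == i)%:R) => k; rewrite mxE eqxx /=.
    by case: eqVneq => [->|_]; rewrite ?mulr1 ?mul1r ?mul0r ?mulr0.
  rewrite /root_form (bigD1 i) //= [X in _ + X]big1 ?addr0 => [|k ki]; last first.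
    by apply: big1 => l _; rewrite !mxE (negbTE ki) /= mul0r mul0r.
  rewrite (bigD1 i) //= big1 ?addr0 => [|k ki].
    by rewrite !mxE !eqxx a2 !mul1r mulrC.
  by rewrite !mxE (negbTE ki) eqxx /= mulr0 mul0r.
set c := foldr _ _ w in IHf IHz *.
set m := \sum_j0 a j j0 * c 0 j0.
have cE k : simple_reflection a j c 0 k = c 0 k - m * (k == j)%:R.
  by rewrite /simple_reflection -/m !mxE eqxx.
split; last first.
  exists (fun k => z k - (k == j)%:R * \sum_l z l * a l j) => k.
  rewrite cE mulrBl IHz mulrBr; congr (_ - _).
  case: eqVneq => [->|_]; last by rewrite mulr0 !mul0r mulr0.
  rewrite mulr1 mul1r /m mulr_suml mulr_sumr; apply: eq_bigr => l _.
  by rewrite mulrC mulrA sym mulrAC mulrA -IHz; ring.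
pose row c k := \sum_l c 0 l * ((d k)%:R * a k l).
have rowE c' : root_form a d c' c' = \sum_k c' 0 k * row c' k.
  apply: eq_bigr => k _; rewrite /row mulr_sumr; apply: eq_bigr => l _.
  by rewrite [RHS]mulrA.
rewrite rowE in IHf; rewrite rowE -IHf.
have rowj : row c j = (d j)%:R * m.
  by rewrite /row /m mulr_sumr; apply: eq_bigr => l _; ring.
have rowS k : row (simple_reflection a j c) k = row c k - m * ((d k)%:R * a k j).
  rewrite /row; under eq_bigr => l _ do rewrite cE mulrBl.
  rewrite sumrB; congr (_ - _); rewrite (bigD1 j) //= eqxx mulr1 big1 ?addr0 // => l lj.
  by rewrite (negbTE lj) mulr0 mul0r.
under eq_bigr => k _ do rewrite cE rowS mulrBl.
rewrite sumrB [X in _ - X](bigD1 j) //= [X in _ - (_ + X)]big1 => [|k kj]; last first.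
  by rewrite (negbTE kj) mulr0 mul0r.
rewrite eqxx mulr1 addr0 rowj a2.
under eq_bigr => k _ do rewrite mulrBr.
rewrite sumrB.
have -> : \sum_k c 0 k * (m * ((d k)%:R * a k j)) = m * ((d j)%:R * m).
  rewrite -rowj /row mulr_sumr; apply: eq_bigr => k _.
  by rewrite sym; ring.
by ring.
Qed.
End RootForm.

Section RootH.
Variables (K : numFieldType) (g : contragredient K) (d : 'I_(rk g) -> nat).
Hypothesis d_sym : symmetrizer (cmat g) d.
Notation n := (rk g).
Notation a := (cmat g).

Lemma cmat_diag i : a i i = 2.
Proof. by case: (cmat_gcm g). Qed.

Lemma root_h_coroot (c : 'rV[int]_n) :
  exists z : 'I_n -> int, root_h d c = \sum_i (z i)%:~R *: coroot i.
Proof.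
rewrite /root_h; case: asboolP => [[w [i cE]]|_]; last by exists (fun i => c 0 i * (d i)%:R).
have [] := root_form_real cmat_diag d_sym w i; rewrite -cE => fE [z zE].
exists z; rewrite fE /root_t scaler_sumr; apply: eq_bigr => k _.
rewrite zE scalerA; congr (_ *: _); rewrite !intrM.
have d0 : ((d i)%:R : int)%:~R != 0 :> K.
  by have [/(_ i) d0 _] := d_sym; rewrite intr_eq0 pnatr_eq0 -lt0n.
by move: (((d i)%:R : int)%:~R : K) ((z k)%:~R : K) d0 => x y x0; field.
Qed.

Lemma weight_root_t (c : 'rV[int]_n) : weight c (root_t d c) = (root_form a d c c)%:~R.
Proof.
rewrite /root_t weight_sum /root_form rmorph_sum; apply: eq_bigr => i _ /=.
rewrite weightZl weight_coroot -intrM mulr_sumr; congr (_%:~R).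
by apply: eq_bigr => j _; ring.
Qed.

Lemma weight_root_h (c : 'rV[int]_n) : real_root (g := g) c -> weight c (root_h d c) = 2.
Proof.
move=> cr; rewrite /root_h asboolT // weightZl weight_root_t divfK // intr_eq0.
have [w [i ->]] := cr; have [-> _] := root_form_real cmat_diag d_sym w i.
by have [/(_ i) d0 _] := d_sym; rewrite mulf_neq0 // pnatr_eq0 -lt0n.
Qed.

Lemma weight_root_h_int (c c' : 'rV[int]_n) : exists k : int, weight c (root_h d c') = k%:~R.
Proof.
have [z ->] := root_h_coroot c'.
exists (\sum_i z i * \sum_j a i j * c 0 j).
rewrite weight_sum rmorph_sum; apply: eq_bigr => i _ /=.
by rewrite weightZl weight_coroot intrM.
Qed.
End RootH.

(** * The quotient by a left ideal as a module *)

Section LeftIdealQuotient.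
Variables (B : nzRingType) (x : B).
Implicit Types (y z b : B) (u v : lquot x).

Lemma lclassB y z : lclass x (y - z) = lclass x y - lclass x z.
Proof. exact: (@raddfB _ _ \pi_({ideal_quot (left_ideal x)})%qT). Qed.

HB.instance Definition _ := GRing.isZmodMorphism.Build B (lquot x) (lclass x) lclassB.

Lemma lclassD y z : lclass x (y + z) = lclass x y + lclass x z.
Proof. exact: raddfD. Qed.

Lemma lclassN y : lclass x (- y) = - lclass x y.
Proof. exact: raddfN. Qed.

Lemma lclassP y z : lclass x y = lclass x z <-> exists b, y - z = b * x.
Proof.
split=> [/eqP|yz]; first by rewrite -Quotient.idealrBE => /asboolP.
by apply/eqP; rewrite -Quotient.idealrBE; apply/asboolP.
Qed.

Lemma lclass0P y : lclass x y = 0 <-> exists b, y = b * x.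
Proof. by rewrite -(raddf0 (lclass x)) lclassP subr0. Qed.

Lemma lreprK u : lclass x (lrepr u) = u.
Proof. exact: reprK. Qed.

Lemma lclass_mull b y z : lclass x y = lclass x z -> lclass x (b * y) = lclass x (b * z).
Proof. by move=> /lclassP[c yz]; apply/lclassP; exists (b * c); rewrite -mulrBr yz mulrA. Qed.

Definition lquot_act b u : lquot x := lclass x (b * lrepr u).

Lemma lquot_actE b y : lquot_act b (lclass x y) = lclass x (b * y).
Proof. by apply: lclass_mull; rewrite lreprK. Qed.

Lemma lquot_actB b u v : lquot_act b (u - v) = lquot_act b u - lquot_act b v.
Proof. by rewrite -[u]lreprK -[v]lreprK -lclassB !lquot_actE mulrBr lclassB. Qed.

HB.instance Definition _ b :=
  GRing.isZmodMorphism.Build (lquot x) (lquot x) (lquot_act b) (lquot_actB b).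

Lemma lquot_actA b c u : lquot_act b (lquot_act c u) = lquot_act (b * c) u.
Proof. by rewrite -[u]lreprK !lquot_actE mulrA. Qed.

Lemma lquot_act1 u : lquot_act 1 u = u.
Proof. by rewrite -[u]lreprK lquot_actE mul1r. Qed.

Lemma lquot_actBl b c u : lquot_act (b - c) u = lquot_act b u - lquot_act c u.
Proof. by rewrite -[u]lreprK !lquot_actE mulrBl lclassB. Qed.

Lemma lquot_act0l u : lquot_act 0 u = 0.
Proof. by rewrite -[0 in LHS](subrr 0) lquot_actBl subrr. Qed.

Lemma lquot_actDl b c u : lquot_act (b + c) u = lquot_act b u + lquot_act c u.
Proof. by rewrite -[u]lreprK !lquot_actE mulrDl raddfD. Qed.

Lemma lquot_act_suml I (r : seq I) (P : pred I) (F : I -> B) u :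
  lquot_act (\sum_(i <- r | P i) F i) u = \sum_(i <- r | P i) lquot_act (F i) u.
Proof.
by apply: (big_morph (lquot_act^~ u)) => [b c|]; [apply: lquot_actDl | apply: lquot_act0l].
Qed.

(** Changing the representative [y] by a multiple of [x] does not matter, since
[x] kills [v]. *)
Lemma mickelsson_mulE y v :
  lquot_act x v = 0 -> mickelsson_mul (lclass x y) v = lquot_act y v.
Proof.
move=> xv; rewrite /mickelsson_mul -/(lquot_act _ v).
have /lclassP[b yb] : lclass x (lrepr (lclass x y)) = lclass x y by rewrite lreprK.
by rewrite -[lrepr _](subrK y) yb lquot_actDl -lquot_actA xv raddf0 add0r.
Qed.

Lemma mickelssonP u : lquot_act x u = 0 -> mickelsson u.
Proof.
move=> /lclass0P[b xu]; exists (lrepr u); split; first by rewrite lreprK.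
by apply/asboolP; exists b.
Qed.
End LeftIdealQuotient.

Section DoubleCoset.
Variables (B : nzRingType) (x y : B).

Lemma dclassP z t : dclass x y z = dclass x y t <-> exists a b, z - t = x * a + b * y.
Proof.
split=> [/eqP|zt]; first by rewrite -Quotient.idealrBE => /asboolP.
by apply/eqP; rewrite -Quotient.idealrBE; apply/asboolP.
Qed.

Lemma dreprK u : dclass x y (drepr u) = u.
Proof. exact: reprK. Qed.
End DoubleCoset.

Lemma fsum_nat (V : zmodType) (G : nat -> V) N :
  (forall n, (N <= n)%N -> G n = 0) -> \sum_(n \in [set: nat]) G n = \sum_(n < N) G n.
Proof.
move=> G0; rewrite fsbig_ord; apply/esym/fsbig_widen => //= n [_ /= /negP].
by rewrite -leqNgt => /G0.
Qed.

(** * The Zhelobenko series for an sl_2-triple *)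

Section Rcomm.
Variables (K : pzRingType) (B : algType K) (x : B).

Lemma rcomm_linear : linear (rcomm x).
Proof.
by move=> c y z; rewrite /rcomm mulrDr mulrDl -scalerAr -scalerAl scalerBr opprD addrACA.
Qed.

HB.instance Definition _ := GRing.isLinear.Build K B B _ (rcomm x) rcomm_linear.

Lemma rcommM y z : rcomm x (y * z) = rcomm x y * z + y * rcomm x z.
Proof. by rewrite /rcomm mulrBl mulrBr !mulrA addrA subrK. Qed.
End Rcomm.

Lemma iter_rcomm_morph (K : pzRingType) (A B : algType K) (i : {lrmorphism A -> B})
    (x y : A) n :
  iter n (rcomm (i x)) (i y) = i (iter n (rcomm x) y).
Proof. by elim: n => //= n ->; rewrite /rcomm rmorphB !rmorphM. Qed.

Section Sl2.
Variables (K : numFieldType) (B : algType K) (D : comUnitAlgType K).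
Variables (dA : {lrmorphism D -> B}) (tau : {lrmorphism D -> D}) (E F : B) (h : D).
Hypotheses (Etau : forall x, E * dA (tau x) = dA x * E)
  (Ftau : forall x, F * dA x = dA (tau x) * F)
  (EF : rcomm E F = dA h)
  (tau_h : tau h = h + 2)
  (h_unit : forall k : int, h + k%:~R \is a GRing.unit).

Lemma dAZ k x : dA (k *: x) = k *: dA x.
Proof. exact: linearZ_LR. Qed.

Lemma h_nat_unit k : h + k%:R \is a GRing.unit.
Proof. exact: (h_unit k). Qed.

Lemma h_subnat_unit k : h - k%:R \is a GRing.unit.
Proof. by have := h_unit (- k%:Z); rewrite rmorphN. Qed.

Lemma tau_subn k : tau (h - k%:R) = h + 2 - k%:R.
Proof. by rewrite rmorphB /= rmorph_nat tau_h. Qed.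

Lemma Fexp_tau n x : F ^+ n * dA x = dA (iter n tau x) * F ^+ n.
Proof.
elim: n => [|n IHn] /=; first by rewrite expr0 mul1r mulr1.
by rewrite exprS -mulrA IHn mulrA Ftau -mulrA.
Qed.

Lemma iter_tau_h n c : iter n tau (h + c%:~R) = h + (c + 2 * n%:Z)%:~R.
Proof.
elim: n => [|n IHn]; first by rewrite mulr0 addr0.
rewrite iterS IHn rmorphD /= rmorph_int tau_h -addrA; congr (_ + _).
by rewrite -[2]/(2%:~R) -intrD; congr (_%:~R); lia.
Qed.

Lemma h_Fexp n c : dA (h + c%:~R) * F ^+ n = F ^+ n * dA (h + (c - 2 * n%:Z)%:~R).
Proof. by rewrite Fexp_tau iter_tau_h subrK. Qed.

Lemma E_Fexp n : E * F ^+ n.+1 = F ^+ n.+1 * E + n.+1%:R *: (F ^+ n * dA (h - n%:R)).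
Proof.
elim: n => [|n IHn].
  have /eqP := EF; rewrite /rcomm subr_eq addrC => /eqP.
  by rewrite expr1 expr0 mul1r subr0 scale1r.
rewrite exprSr mulrA IHn mulrDl -mulrA -scalerAl.
have /eqP := EF; rewrite /rcomm subr_eq addrC => /eqP ->.
rewrite mulrDr mulrA -addrA; congr (_ + _).
rewrite -mulrA (_ : dA (h - n%:R) * F = F * dA (h - n.+2%:R)); last first.
  have := h_Fexp 1 (- n%:Z); rewrite expr1 rmorphN => ->.
  by congr (F * dA (h + _)); rewrite -[RHS](rmorphN (intmul 1) n.+2%:Z); congr (_%:~R); lia.
have key : dA h + n.+1%:R *: dA (h - n.+2%:R) = n.+2%:R *: dA (h - n.+1%:R).
  transitivity (dA (h + n.+1%:R *: (h - n.+2%:R))); first by rewrite [RHS]linearD /= dAZ.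
  transitivity (dA (n.+2%:R *: (h - n.+1%:R))); last by rewrite dAZ.
  congr (dA _); rewrite !scaler_nat -[(_ - _) *+ n.+1]mulr_natl.
  rewrite -[(_ - _) *+ n.+2]mulr_natl -[n.+2]addn2 -[n.+1]addn1 !natrD.
  by ring.
by rewrite mulrA -exprSr scalerAr -mulrDr key -scalerAr.
Qed.

Definition hfall n : D := \prod_(i < n) (h - i%:R).

Lemma hfallS n : hfall n.+1 = hfall n * (h - n%:R).
Proof. by rewrite /hfall big_ord_recr. Qed.

Lemma hfall_unit n : hfall n \is a GRing.unit.
Proof. by apply: rpred_prod => i _; apply: h_subnat_unit. Qed.

Definition fpow n : B := F ^+ n * dA (hfall n)^-1.

Lemma h_fpow n c : dA (h + c%:~R) * fpow n = fpow n * dA (h + (c - 2 * n%:Z)%:~R).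
Proof.
by rewrite /fpow mulrA h_Fexp -!mulrA -!rmorphM mulrC.
Qed.

Lemma fpowS n : F ^+ n.+1 * dA (hfall n)^-1 = fpow n.+1 * dA (h - n%:R).
Proof.
rewrite /fpow -mulrA -rmorphM; congr (_ * dA _).
by rewrite hfallS invrM ?hfall_unit ?h_subnat_unit // mulrC mulrA mulrV ?mul1r ?h_subnat_unit.
Qed.

(** The factor h+k+2 of the recursion for the family Q_k comes from this
relation. *)
Lemma F_fpow n : F * fpow n = dA (h + n.+2%:R) * fpow n.+1.
Proof.
rewrite /fpow mulrA -exprS fpowS -[n.+2%:R]/(n.+2%:Z%:~R) h_fpow.
congr (_ * dA (h + _)); rewrite -[LHS](rmorphN (intmul 1) n%:Z); congr (_%:~R); lia.
Qed.

Notation pi := (lclass E).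

(** Right multiplication by an element in the image of [tau] preserves the
left ideal generated by [E]. *)
Lemma pi_mulr_tau x y c : pi x = pi y -> pi (x * dA (tau c)) = pi (y * dA (tau c)).
Proof.
move=> /lclassP[b xy]; apply/lclassP; exists (b * dA c).
by rewrite -mulrBl xy -!mulrA Etau.
Qed.

Definition hrise n : D := \prod_(i < n) (h - (i + 2)%:R).

Lemma hrise_unit n : hrise n \is a GRing.unit.
Proof. by apply: rpred_prod => i _; apply: h_subnat_unit. Qed.

(** The shift by [tau] maps the denominators of the extremal projector to those
of the Zhelobenko series. *)
Lemma tau_hrise n : tau (hrise n)^-1 = (hfall n)^-1.
Proof.
rewrite rmorphV ?hrise_unit //; congr (_^-1); rewrite rmorph_prod /=.
by apply: eq_bigr => i _; rewrite tau_subn natrD; ring.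
Qed.

Lemma E_fpow n : pi (E * fpow n) = pi (n%:R *: fpow n.-1).
Proof.
apply/lclassP; exists (F ^+ n * dA (hrise n)^-1).
rewrite /fpow mulrA -[RHS]mulrA -Etau tau_hrise.
case: n => [|n]; first by rewrite expr0 !mul1r mulr1 scale0r subr0.
rewrite E_Fexp mulrDl -!mulrA -addrA -[RHS]addr0; congr (_ + _).
apply/eqP; rewrite subr_eq0 -scalerAl -mulrA -rmorphM; apply/eqP; congr (_ *: (_ * dA _)).
by rewrite hfallS invrM ?hfall_unit ?h_subnat_unit // mulrA mulrV ?mul1r ?h_subnat_unit.
Qed.

Notation c := (expcoef (-1 : K)).

(** The shift [k] makes room for the second factor of a product: by the Leibniz
rule, the series of a product is a combination of shifted series. *)
Definition zseries k N (a : B) : B := \sum_(l < N) c l *: (iter l (rcomm E) a * fpow (k + l)).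

Lemma zseries_le k N M a : (N <= M)%N -> iter N (rcomm E) a = 0 ->
  zseries k M a = zseries k N a.
Proof.
move=> /subnKC <- aN; rewrite /zseries big_split_ord /= [X in _ + X]big1 ?addr0 // => i _.
by rewrite (iter_nil_le (leq_addr i N) aN) mul0r scaler0.
Qed.

Lemma zseries_Leibniz k N M a b :
  iter N (rcomm E) b = 0 -> iter M (rcomm E) a = 0 ->
  zseries k (N + M) (b * a) = \sum_(j < N) c j *: (iter j (rcomm E) b * zseries (k + j) M a).
Proof.
move=> bN aM.
rewrite /zseries (exp_Leibniz (mu := fun b a => b * a)
  (G := fun n x => x * fpow (k + n)) _ _ (rcommM E)).
- apply: eq_bigr => i _; rewrite mulr_sumr scaler_sumr; apply: eq_bigr => j _.
  by rewrite -scalerAr scalerA -mulrA addnA.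
- by move=> n r x y; rewrite mulrDl scalerAl.
- by move=> i j /orP[le|le]; rewrite (iter_nil_le le) ?mul0r ?mulr0.
Qed.

Lemma iter_rcomm_mul0 N M a b :
  iter N (rcomm E) b = 0 -> iter M (rcomm E) a = 0 -> iter (N + M) (rcomm E) (b * a) = 0.
Proof.
move=> bN aM; rewrite (iter_Leibniz (mu := fun b a => b * a) (rcommM E)) big1 // => i _.
have [le|lt] := leqP N i; first by rewrite (iter_nil_le le bN) mul0r mul0rn.
by rewrite (iter_nil_le _ aM) ?mulr0 ?mul0rn //; lia.
Qed.

(** The terms E ad^l(a) = ad^(l+1)(a) + ad^l(a) E give two sums that cancel up
to an index shift, except for a factor [k] coming from E F^(k+l). *)
Lemma E_zseries k N a : iter N (rcomm E) a = 0 ->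
  pi (E * zseries k N a) = pi (k%:R *: zseries k.-1 N a).
Proof.
case: N => [|N] aN; first by rewrite /zseries !big_ord0 mulr0 scaler0.
have [t tE] : exists t : nat -> B, forall l, t l = iter l (rcomm E) a by eexists.
have Et l : E * t l = t l.+1 + t l * E by rewrite !tE /= /rcomm subrK.
transitivity (pi (\sum_(l < N.+1) c l *: (t l.+1 * fpow (k + l)) +
                  \sum_(l < N.+1) (l%:R * c l) *: (t l * fpow (k + l).-1) +
                  k%:R *: zseries k.-1 N.+1 a)).
  rewrite /zseries mulr_sumr scaler_sumr -!big_split /= !raddf_sum; apply: eq_bigr => l _ /=.
  rewrite -!tE -scalerAr mulrA Et mulrDl scalerDr -!addrA !raddfD; rewrite /=; congr (_ + _).
  rewrite -mulrA scalerAl (lclass_mull _ (E_fpow _)) -raddfD /=; congr (pi _).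
  rewrite -scalerAr -scalerAl !scalerA natrD mulrDl scalerDl addrC.
  congr (_ *: _ + _); case: k => [|k]; last by rewrite addSn.
  by rewrite !mul0r !scale0r.
congr (pi _); rewrite -[RHS]add0r; congr (_ + _).
have tN : t N.+1 = 0 by rewrite tE.
rewrite [X in X + _]big_ord_recr [X in _ + X]big_ord_recl /= tN.
rewrite mul0r scaler0 addr0 mul0r scale0r add0r -big_split big1 // => l _ /=.
by rewrite /bump add1n addnS /= expcoefS mulN1r scaleNr subrr.
Qed.

Lemma EE0 : iter 1 (rcomm E) E = 0.
Proof. by rewrite /= /rcomm subrr. Qed.

Lemma rcomm_E_D x s : tau x = x + s%:A -> rcomm E (dA x) = - s *: E.
Proof.
move=> tx; rewrite /rcomm -Etau tx rmorphD /= rmorph_alg mulrDr opprD addrA subrr sub0r.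
by rewrite -scalerAr mulr1 scaleNr.
Qed.

Lemma iter2_E_D x s : tau x = x + s%:A -> iter 2 (rcomm E) (dA x) = 0.
Proof. by move=> /rcomm_E_D /= ->; rewrite linearZ /= /rcomm subrr scaler0. Qed.

Lemma tau_h_alg : tau h = h + 2%:A.
Proof. by rewrite tau_h scaler_nat. Qed.

Lemma iter3_E_F : iter 3 (rcomm E) F = 0.
Proof. by have := iter2_E_D tau_h_alg; rewrite -EF. Qed.

Lemma expcoef2_E_F : c 2 *: rcomm E (rcomm E F) = - E.
Proof.
rewrite EF (rcomm_E_D tau_h_alg) scalerA expcoef2 sqrrN expr1n mul1r mulrN.
rewrite mulVf ?scaleN1r //.
by rewrite pnatr_eq0.
Qed.

Lemma zseries_F k N a : iter N (rcomm E) a = 0 ->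
  pi (zseries k (3 + N) (F * a)) =
  pi (F * zseries k N a - dA (h + k.+2%:R) * zseries k.+1 N a).
Proof.
move=> aN; rewrite (zseries_Leibniz _ iter3_E_F aN).
rewrite !big_ord_recl big_ord0 addr0 /bump /= addn0 addn1 addn2.
rewrite expcoef0 expcoef1 scale1r scaleN1r [c 2 *: _]scalerAl expcoef2_E_F EF mulNr.
rewrite [dA (h + _)]rmorphD rmorph_nat mulrDl opprD !lclassD !lclassN (E_zseries _ aN).
by rewrite scaler_nat -[k.+2.-1]/(k.+1) mulr_natl.
Qed.

(** * The extremal projector *)

Lemma Eexp_h n c' : E ^+ n * dA (h + c'%:~R) = dA (h + (c' - 2 * n%:Z)%:~R) * E ^+ n.
Proof.
have Eexp x : E ^+ n * dA (iter n tau x) = dA x * E ^+ n.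
  elim: n => [|m IHm]; first by rewrite expr0 mul1r mulr1.
  by rewrite exprSr -mulrA iterS Etau mulrA IHm -mulrA.
by rewrite -Eexp iter_tau_h subrK.
Qed.

Lemma F_Eexp n : F * E ^+ n.+1 = E ^+ n.+1 * F - n.+1%:R *: (dA (h - n%:R) * E ^+ n).
Proof.
have FE : F * E = E * F - dA h by rewrite -EF /rcomm opprB addrC subrK.
elim: n => [|n IHn]; first by rewrite expr1 expr0 mulr1 subr0 scale1r.
rewrite exprSr mulrA IHn mulrBl -[_ * F * E]mulrA FE mulrBr !mulrA -exprSr.
rewrite -scalerAl -[_ * E ^+ n * E]mulrA -exprSr.
rewrite -addrA -opprD; congr (_ - _).
have := Eexp_h n.+1 0; rewrite addr0 => ->.
have key : dA (h + (0 - 2 * n.+1%:Z)%:~R) + n.+1%:R *: dA (h - n%:R) =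
    n.+2%:R *: dA (h - n.+1%:R).
  transitivity (dA (h + (0 - 2 * n.+1%:Z)%:~R + n.+1%:R *: (h - n%:R))).
    by rewrite [RHS]linearD /= dAZ.
  transitivity (dA (n.+2%:R *: (h - n.+1%:R))); last by rewrite dAZ.
  congr (dA _); rewrite !scaler_nat -[(_ - _) *+ n.+1]mulr_natl sub0r rmorphN rmorphM /=.
  rewrite -[(_ - _) *+ n.+2]mulr_natl -[n.+2]addn2 -[n.+1]addn1 !natrD /=.
  rewrite -[(n + 1)%:~R]/((n + 1)%:R) natrD; ring.
by rewrite scalerAl -mulrDl key -scalerAl.
Qed.

Definition extremal_term (y : B) n : B :=
  (n`!%:R)^-1 *: (dA (hrise n)^-1 * E ^+ n * F ^+ n * y).

(** The sum telescopes, so that [F] maps a partial sum to its boundary term. *)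
Lemma F_extremal_sum y N : F * \sum_(n < N.+1) extremal_term y n =
  (N`!%:R)^-1 *: (dA (hfall N)^-1 * E ^+ N * (F ^+ N.+1 * y)).
Proof.
have Fp n : F * extremal_term y n =
    (n`!%:R)^-1 *: (dA (hfall n)^-1 * (F * E ^+ n) * (F ^+ n * y)).
  by rewrite /extremal_term -scalerAr !mulrA Ftau tau_hrise.
elim: N => [|N IHN]; first by rewrite big_ord1 Fp !expr0 !mulr1 !mul1r -mulrA expr1.
rewrite big_ord_recr /= mulrDr IHN Fp F_Eexp mulrBr mulrBl scalerBr addrC.
rewrite -[RHS]addr0 -addrA; congr (_ + _).
  by congr (_ *: _); rewrite [F ^+ N.+2]exprS !mulrA.
apply/eqP; rewrite addrC subr_eq0; apply/eqP.
rewrite -scalerAr -scalerAl scalerA; congr (_ *: _).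
  rewrite factS natrM invfM mulrAC mulVf ?mul1r // pnatr_eq0 //.
congr (_ * _); rewrite mulrA -rmorphM; congr (dA _ * _).
by rewrite hfallS invrM ?hfall_unit ?h_subnat_unit // mulrAC mulVr ?mul1r ?h_subnat_unit.
Qed.

Lemma extremal_sum_congr y N : exists a, \sum_(n < N.+1) extremal_term y n = y + E * a.
Proof.
elim: N => [|N [a IHN]].
  exists 0; rewrite big_ord1 /extremal_term fact0 invr1 scale1r /hrise big_ord0 invr1 rmorph1.
  by rewrite !expr0 !mul1r mulr0 addr0.
rewrite big_ord_recr /= IHN.
exists (a + (N.+1`!%:R)^-1 *: (dA (tau (hrise N.+1)^-1) * E ^+ N * F ^+ N.+1 * y)).
rewrite mulrDr addrA; congr (_ + _); rewrite /extremal_term -scalerAr; congr (_ *: _).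
by rewrite !mulrA Etau -[dA _ * E * _]mulrA -exprS.
Qed.

Lemma extremal_projE y N u : F ^+ N * y = u * F ->
  extremal_proj dA E F h y = lclass F (\sum_(n < N.+1) extremal_term y n).
Proof.
move=> Fy; rewrite /extremal_proj (@fsum_nat _ _ N.+1) ?raddf_sum // => n lt_Nn.
apply/lclass0P.
exists ((n`!%:R)^-1 *: (dA (hrise n)^-1 * E ^+ n * (F ^+ (n - N) * u))).
rewrite -scalerAl -!mulrA -Fy; congr (_ *: (_ * (_ * _))).
by rewrite mulrA -exprD subnK // ltnW.
Qed.

(** * Multiplicativity of the Zhelobenko map *)

Section Zhelobenko.
Variables (A : algType K) (iA : {lrmorphism A -> B}) (f : A).
Hypotheses (fE : iA f = F)
  (E_nil : forall a : A, loc_nil (rcomm E) (iA a))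
  (right_gen : forall P : B -> Prop, P 0 -> (forall x y, P x -> P y -> P (x + y)) ->
     (forall a d, P (iA a * dA d)) -> forall z, P z)
  (left_gen : forall P : B -> Prop, P 0 -> (forall x y, P x -> P y -> P (x + y)) ->
     (forall a d, P (dA d * iA a)) -> forall z, P z)
  (D_ind : forall P : D -> Prop, (forall x y, P x -> P y -> P (x + y)) ->
     (forall x y, P x -> P y -> P (x * y)) ->
     (forall x, x \is a GRing.unit -> P x -> P x^-1) ->
     (forall x y s, iA y = dA x -> tau x = x + s%:A -> P x) -> forall x, P x).
Variable q : {additive B -> lquot E}.
Hypothesis qE : forall a N d, iter N (rcomm E) (iA a) = 0 ->
  q (iA a * dA d) = pi (zseries 0 N (iA a) * dA (tau d)).

(** The maps Q_k of the introduction, defined on the whole algebra from [q] by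
solving for Q_(k+1) the relation [zshift_F]; [zshiftE] identifies them with
the shifted series. *)
Fixpoint zshift k (z : B) : lquot E :=
  if k is k'.+1 then
    lquot_act (dA (h + k'.+2%:R)^-1) (lquot_act F (zshift k' z) - zshift k' (F * z))
  else q z.

Lemma zshiftB k : {morph zshift k : y z / y - z}.
Proof.
elim: k => [|k IHk] y z /=; first exact: raddfB.
rewrite mulrBr !IHk (lquot_actB F) -(lquot_actB (dA _)); congr (lquot_act _ _).
by rewrite !opprB addrACA [RHS]addrACA; congr (_ + _); rewrite addrC.
Qed.

HB.instance Definition _ k := GRing.isZmodMorphism.Build B (lquot E) (zshift k) (zshiftB k).

Lemma zshiftE k a N d : iter N (rcomm E) (iA a) = 0 ->
  zshift k (iA a * dA d) = pi (zseries k N (iA a) * dA (tau d)).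
Proof.
elim: k a N => [|k IHk] a N aN; first exact: qE.
have faE : iA (f * a) = F * iA a by rewrite rmorphM /= fE.
have FaE : F * (iA a * dA d) = iA (f * a) * dA d by rewrite faE mulrA.
have FaN : iter (3 + N) (rcomm E) (iA (f * a)) = 0.
  by rewrite faE; apply: iter_rcomm_mul0 aN; apply: iter3_E_F.
rewrite [LHS]/= (IHk _ _ aN) FaE (IHk _ _ FaN) faE.
rewrite (pi_mulr_tau _ (zseries_F k aN)) lquot_actE -lclassB lquot_actE.
congr (pi _); rewrite mulrBl [F * (_ * _)]mulrA subKr !mulrA -rmorphM.
by rewrite mulVr ?h_nat_unit // rmorph1 mul1r.
Qed.

Lemma zshift_Leibniz k N b z : iter N (rcomm E) (iA b) = 0 ->
  zshift k (iA b * z) =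
  \sum_(j < N) lquot_act (c j *: iter j (rcomm E) (iA b)) (zshift (k + j) z).
Proof.
move=> bN; elim/right_gen: z => [|x y IHx IHy|a d].
- by rewrite mulr0 raddf0 big1 // => j _; rewrite !raddf0.
- by rewrite mulrDr raddfD /= IHx IHy -big_split; apply: eq_bigr => j _ /=; rewrite !raddfD.
have [M aM] := E_nil a.
have baM : iter (N + M) (rcomm E) (iA (b * a)) = 0.
  by rewrite rmorphM /=; apply: iter_rcomm_mul0.
rewrite mulrA -rmorphM (zshiftE _ _ baM) rmorphM /= (zseries_Leibniz _ bN aM).
rewrite mulr_suml raddf_sum; apply: eq_bigr => j _ /=.
by rewrite (zshiftE _ _ aM) lquot_actE -!scalerAl mulrA.
Qed.

Lemma E_zmap k z : lquot_act E (zshift k z) = lquot_act k%:R (zshift k.-1 z).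
Proof.
elim/right_gen: z => [|x y IHx IHy|a d]; first by rewrite !raddf0.
  by rewrite !raddfD /= IHx IHy.
have [M aM] := E_nil a.
rewrite !(zshiftE _ _ aM) !lquot_actE !mulrA; apply: pi_mulr_tau.
by rewrite (E_zseries _ aM) scaler_nat mulr_natl.
Qed.

Lemma zshift_F k z : zshift k (F * z) =
  lquot_act F (zshift k z) - lquot_act (dA (h + k.+2%:R)) (zshift k.+1 z).
Proof.
rewrite /= lquot_actA -rmorphM divrr ?h_nat_unit // rmorph1 lquot_act1.
by rewrite opprB addrC subrK.
Qed.

Lemma zshift_E e z : iA e = E -> zshift 0 (E * z) = 0.
Proof.
move=> eE; have e0 : iter 1 (rcomm E) (iA e) = 0 by rewrite eE EE0.
have := zshift_Leibniz 0 z e0; rewrite eE => ->.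
by rewrite big_ord1 expcoef0 scale1r E_zmap lquot_act0l.
Qed.

(** For an element of the Cartan subalgebra this is the Leibniz formula, where
ad_E contributes a multiple of E and [E_zshift] turns it into the [k.+1]-fold
shift; sums, products and inverses then give all of [D]. *)
Lemma zshift_D k x z : zshift k (dA x * z) = lquot_act (dA (iter k.+1 tau x)) (zshift k z).
Proof.
have itP n : [/\ {morph iter n tau : x y / x + y},
    {morph iter n tau : x y / x * y} & iter n tau 1 = 1].
  elim: n => [|n [IHD IHM IH1]]; first by [].
  split; [move=> x' y'|move=> x' y'|]; rewrite !iterS.
  - by rewrite IHD rmorphD.
  - by rewrite IHM rmorphM.
  - by rewrite IH1 rmorph1.
have [iterD iterM iter1] := itP k.+1.
pose P x := forall z, zshift k (dA x * z) = lquot_act (dA (iter k.+1 tau x)) (zshift k z).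
apply: (D_ind (P := P)) x z => [x y IHx IHy|x y IHx IHy|x xu IHx|x y s yx tx] z.
- by rewrite iterD !rmorphD mulrDl lquot_actDl -IHx -IHy raddfD.
- by rewrite rmorphM -mulrA IHx IHy lquot_actA -rmorphM iterM.
- have iu : iter k.+1 tau x * iter k.+1 tau x^-1 = 1 by rewrite -iterM divrr.
  have {2}-> : z = dA x * (dA x^-1 * z) by rewrite mulrA -rmorphM divrr // rmorph1 mul1r.
  by rewrite IHx lquot_actA -rmorphM mulrC iu rmorph1 lquot_act1.
have iterx n : iter n tau x = x + n%:R * s%:A.
  elim: n => [|n IHn]; first by rewrite mul0r addr0.
  rewrite iterS IHn rmorphD rmorphM rmorph_nat /= tx rmorph_alg -natr1.
  by ring.
have y2 : iter 2 (rcomm E) (iA y) = 0 by rewrite yx (iter2_E_D tx).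
have := zshift_Leibniz k z y2; rewrite yx => ->.
rewrite !big_ord_recl big_ord0 addr0 /bump /= addn0 addn1 expcoef0 expcoef1 (rcomm_E_D tx).
rewrite scale1r scalerA mulN1r opprK -[tau (iter k tau x)]/(iter k.+1 tau x) iterx.
rewrite rmorphD lquot_actDl; congr (_ + _).
rewrite -[s *: E]mulr_algl -lquot_actA E_zmap lquot_actA; congr (lquot_act _ _).
by rewrite rmorphM rmorph_nat /= rmorph_alg mulr_algl mulr_algr.
Qed.

(** By the Leibniz formula it is enough that the series of [F] itself vanishes,
and that series is F Q_k(1) - (h+k+2) Q_(k+1)(1) with Q_k(1) = F^k [h]_k^-1. *)
Lemma zshift_FK k z : zshift k (z * F) = 0.
Proof.
have F0 n : zshift n F = 0.
  have f3 : iter 3 (rcomm E) (iA f) = 0 by rewrite fE iter3_E_F.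
  have := zshiftE n 1 f3; rewrite !rmorph1 !mulr1 fE => ->.
  have -> : zseries n 3 F = zseries n (3 + 1) (F * 1).
    by rewrite mulr1 (@zseries_le n 3) // iter3_E_F.
  rewrite (@zseries_F _ 1); last by rewrite /= /rcomm mulr1 mul1r subrr.
  rewrite /zseries !big_ord1 /= expcoef0 !scale1r !mul1r !addn0.
  by rewrite F_fpow subrr raddf0.
elim/left_gen: z => [|x y IHx IHy|a d]; first by rewrite mul0r raddf0.
  by rewrite mulrDl raddfD /= IHx IHy addr0.
have [N aN] := E_nil a.
rewrite -mulrA zshift_D (zshift_Leibniz _ _ aN) big1 ?raddf0 // => j _.
by rewrite F0 raddf0.
Qed.

Lemma zshift_normal k z u : F * z = u * F -> zshift k z = lquot_act (fpow k) (zshift 0 z).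
Proof.
move=> Fz; elim: k => [|k IHk].
  by rewrite /fpow expr0 mul1r /hfall big_ord0 invr1 rmorph1 lquot_act1.
have := zshift_F k z; move: (zshift k.+1 z) => zk.
rewrite Fz zshift_FK IHk lquot_actA F_fpow => /esym/eqP.
rewrite subr_eq0 -lquot_actA => /eqP /(congr1 (lquot_act (dA (h + k.+2%:R)^-1))).
by rewrite !lquot_actA !mulrA -!rmorphM mulVr ?h_nat_unit // !rmorph1 mul1r lquot_act1 => <-.
Qed.

(** Normality of [z], here [F * z = u * F], is inherited by [dA d * z]; this
allows the factors from [D] in [y] to be absorbed in [z]. *)
Lemma zhelobenko_mul y z u : F * z = u * F -> q (y * z) = mickelsson_mul (q y) (q z).
Proof.
move=> Fz; have E0 t : lquot_act E (q t) = 0 by rewrite -[q t]/(zshift 0 t) E_zmap lquot_act0l.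
have mE r t : mickelsson_mul (lclass E r) (q t) = lquot_act r (q t) by apply: mickelsson_mulE.
have mD s s' t : mickelsson_mul (s + s') (q t) =
    mickelsson_mul s (q t) + mickelsson_mul s' (q t).
  by rewrite -[s]lreprK -[s']lreprK -lclassD !mE lquot_actDl.
elim/right_gen: y => [|x y IHx IHy|a d].
- by rewrite mul0r raddf0 -[X in mickelsson_mul X _](raddf0 (lclass E)) mE lquot_act0l.
- by rewrite mulrDl !raddfD /= IHx IHy mD.
have [N aN] := E_nil a; rewrite (qE _ aN) mE -mulrA.
have Fdz : F * (dA d * z) = dA (tau d) * u * F by rewrite mulrA Ftau -!mulrA Fz.
have := zshift_Leibniz 0 (dA d * z) aN; rewrite [zshift 0 _]/= => ->.
rewrite -lquot_actA -[X in _ = lquot_act _ X](zshift_D 0) /zseries lquot_act_suml.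
apply: eq_bigr => j _; rewrite (zshift_normal _ Fdz) lquot_actA -scalerAl add0n.
by [].
Qed.

Hypotheses (e : A) (eE : iA e = E) (F_nil : forall a : A, loc_nil (rcomm F) (iA a)).

(** Left multiplication by [F] is ad_F plus right multiplication by [F], and
these commute; local nilpotence of ad_F leaves a factor [F] on the right. *)
Lemma F_locally_absorbed y : exists N u, F ^+ N * y = u * F.
Proof.
suff [N HN] : exists N, forall n, (N <= n)%N -> exists u, F ^+ n * y = u * F.
  by have [u Hu] := HN N (leqnn N); exists N, u.
elim/left_gen: y => [|x y [N HN] [M HM]|a d].
- by exists 0%N => n _; exists 0; rewrite mulr0 mul0r.
- exists (maxn N M) => n; rewrite geq_max => /andP[/HN[u Hu] /HM[v Hv]].
  by exists (u + v); rewrite mulrDr mulrDl Hu Hv.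
have [N aN] := F_nil a; exists N => n le_Nn.
have FL : linear ( *%R F) by move=> k x y; rewrite mulrDr scalerAr.
pose L : {linear B -> B} := HB.pack ( *%R F) (GRing.isLinear.Build _ _ _ _ ( *%R F) FL).
have iterL m x : iter m L x = F ^+ m * x.
  by elim: m => [|m IHm]; rewrite ?expr0 ?mul1r // iterS IHm /= exprS mulrA.
have LD x y : L (x * y) = rcomm F x * y + x * L y.
  by rewrite /= /rcomm mulrBl !mulrA subrK.
(* The Leibniz rule for the product a * 1 expands F^n a in powers of ad_F. *)
have := iter_Leibniz (mu := fun x y => x * y) LD n (iA a) 1.
rewrite big_ord_recr /= (iter_nil_le le_Nn aN) mul0r mul0rn addr0 mulr1 iterL => Fna.
exists (dA (iter n tau d) * \sum_(i < n) iter i (rcomm F) (iA a) * F ^+ (n - i.+1) *+ 'C(n, i)).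
rewrite mulrA Fexp_tau -!mulrA Fna; congr (_ * _); rewrite mulr_suml.
apply: eq_bigr => i _; rewrite iterL mulr1 mulrnAl; congr (_ *+ _).
by rewrite -mulrA -exprSr subnSK.
Qed.

Theorem zhelobenko_hom : exists qbar : dcoset E F -> lquot E,
  [/\ forall x : B, qbar (dclass E F x) = q x,
      forall a, mickelsson (qbar a)
    & forall a b, qbar (dcoset_mul dA h a b) = mickelsson_mul (qbar a) (qbar b)].
Proof.
have q0 a b : q (E * a + b * F) = 0.
  rewrite raddfD /= -[q (E * a)]/(zshift 0 _) -[q (b * F)]/(zshift 0 _).
  by rewrite zshift_FK (zshift_E _ eE) addr0.
have qd x : q (drepr (dclass E F x)) = q x.
  have /dclassP[a [b ab]] : dclass E F (drepr (dclass E F x)) = dclass E F x by rewrite dreprK.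
  by rewrite -[drepr _](subrK x) ab raddfD /= q0 add0r.
exists (fun a => q (drepr a)); split=> // [a|a b].
  by apply: mickelssonP; rewrite -[q _]/(zshift 0 _) E_zmap lquot_act0l.
rewrite /dcoset_mul qd; set y := drepr b.
have [N [u Fy]] := F_locally_absorbed y.
have := lreprK (extremal_proj dA E F h y); rewrite {2}(extremal_projE Fy).
set z := lrepr _ => /lclassP[v zv].
have [a' sE] := extremal_sum_congr y N.
have -> : q y = q z.
  rewrite -[z](subrK (\sum_(n < N.+1) extremal_term y n)) zv sE addrCA raddfD /=.
  by rewrite [v * F + _]addrC q0 addr0.
apply: (@zhelobenko_mul _ z (F * v + (N`!%:R)^-1 *: (dA (hfall N)^-1 * E ^+ N * (F * u)))).
rewrite -[z](subrK (\sum_(n < N.+1) extremal_term y n)) zv mulrDr F_extremal_sum.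
by rewrite exprS -[F * _ * y]mulrA Fy mulrDl -scalerAl !mulrA.
Qed.

End Zhelobenko.
End Sl2.

(** * Integrality of weights *)

Lemma rcomm_anti (B : pzRingType) (x y : B) : rcomm x y = - rcomm y x.
Proof. by rewrite /rcomm opprB. Qed.

Lemma rcomm_jacobi (K : pzRingType) (B : algType K) (x y z : B) :
  rcomm (rcomm x y) z = rcomm x (rcomm y z) - rcomm y (rcomm x z).
Proof.
rewrite rcomm_anti -[rcomm x y]/(x * y - y * x) [rcomm z _]linearB [X in - X = _]/= !(rcommM z).
rewrite (rcomm_anti z x) (rcomm_anti z y).
move: (rcomm x z) (rcomm y z) => u v; rewrite /rcomm !mulNr !mulrN.
by rewrite !opprB opprK addrC addrACA.
Qed.

Section Sl2Weights.
Variables (K : numFieldType) (V : lmodType K) (X Y T : {linear V -> V}).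
Hypotheses (XY : forall v, X (Y v) = Y (X v) + T v)
  (TX : forall v, T (X v) = X (T v) + 2 *: X v)
  (TY : forall v, T (Y v) = Y (T v) - 2 *: Y v).

(** For the first exponent [m.+1] at which [Y] kills [v], the relation
X Y^(m+1) v = (m+1) (nu - m) Y^m v forces nu = m. *)
Lemma highest_weight_nat nu v : v != 0 -> X v = 0 -> T v = nu *: v ->
  loc_nil Y v -> exists m : nat, nu = m%:R.
Proof.
move=> v0 Xv Tv Yn.
have TYm m : T (iter m Y v) = (nu - (2 * m)%:R) *: iter m Y v.
  elim: m => [|m IHm]; first by rewrite subr0.
  rewrite iterS TY IHm linearZ /= -scalerBl mulnS natrD; congr (_ *: _); ring.
have XYm m : X (iter m.+1 Y v) = (m.+1%:R * (nu - m%:R)) *: iter m Y v.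
  elim: m => [|m IHm]; first by rewrite /= XY Xv linear0 add0r Tv subr0 mul1r.
  rewrite iterS XY IHm linearZ TYm -scalerDl; congr (_ *: _).
  by rewrite -[m.+2]addn2 -[m.+1]addn1 natrM !natrD; ring.
have Yn' : exists m, iter m Y v == 0 by have [m Ym] := Yn; exists m; apply/eqP.
case: (ex_minnP Yn') => -[|m] /eqP Ym min.
  by move: v0; rewrite -[v]/(iter 0 Y v) Ym eqxx.
have X0 : X (iter m.+1 Y v) = 0 by rewrite Ym linear0.
exists m; move: X0 => /eqP; rewrite XYm scaler_eq0 mulf_eq0 pnatr_eq0 /=.
case/orP => [|/eqP Ym0]; first by rewrite subr_eq0 => /eqP.
by have := min m; rewrite Ym0 eqxx ltnn => /(_ isT).
Qed.

(** Raising [v] as far as possible gives a highest weight vector, of weight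
[lam] plus an even number, to which [highest_weight_nat] applies. *)
Lemma sl2_weight_int (P : V -> Prop) lam v : (forall v, P v -> P (X v)) ->
  (forall v, P v -> loc_nil X v) -> (forall v, P v -> loc_nil Y v) ->
  P v -> v != 0 -> T v = lam *: v -> exists k : int, lam = k%:~R.
Proof.
move=> PX Xn Yn Pv v0 Tv; have [N] := Xn v Pv.
elim: N v lam Pv v0 Tv => [|N IHN] v lam Pv v0 Tv XNv.
  by move: v0; rewrite -[v]/(iter 0 X v) XNv eqxx.
have [Xv0|Xv0] := eqVneq (X v) 0.
  by have [m ->] := highest_weight_nat v0 Xv0 Tv (Yn v Pv); exists m.
have TXv : T (X v) = (lam + 2) *: X v by rewrite TX Tv linearZ scalerDl.
have [|k kE] := IHN (X v) (lam + 2) (PX v Pv) Xv0 TXv; first by rewrite -iterSr.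
by exists (k - 2); rewrite intrB -kE addrK.
Qed.
End Sl2Weights.

(** * Local nilpotence and weights on admissible algebras *)

Section Setup.
Variables (K : numFieldType) (g : contragredient K) (d : 'I_(rk g) -> nat).
Hypothesis d_sym : symmetrizer (cmat g) d.
Variables (U : algType K) (iU : {linear g -> U}).
Hypothesis U_env : is_enveloping iU.
Variables (A : algType K) (jA : {lrmorphism U -> A}).

Lemma rcomm_iU x y : rcomm (jA (iU x)) (jA (iU y)) = jA (iU (lie x y)).
Proof. by have [-> _] := U_env; rewrite /rcomm rmorphB !rmorphM. Qed.

Lemma rcomm_lie x y z : rcomm (jA (iU (lie x y))) z =
  rcomm (jA (iU x)) (rcomm (jA (iU y)) z) - rcomm (jA (iU y)) (rcomm (jA (iU x)) z).
Proof. by rewrite -rcomm_iU rcomm_jacobi. Qed.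

Lemma rcommZl (k : K) (x z : A) : rcomm (k *: x) z = k *: rcomm x z.
Proof. by rewrite /rcomm -scalerAl -scalerAr scalerBr. Qed.

Section Admissible.
Variables (P : pred A) (V : subLmodType P).
Hypotheses (V_stable : forall (x : g) (v : V), P (rcomm (jA (iU x)) (val v)))
  (V_tensor : is_tensor (fun (u : U) (v : V) => jA u * val v))
  (V_nil : forall c, real_root c -> forall x : g, root_space c x ->
        forall v : V, exists n, iter n (rcomm (jA (iU x))) (val v) = 0).

Lemma V_stableP (x : g) a : P a -> P (rcomm (jA (iU x)) a).
Proof. by move=> Pa; have := V_stable x (Sub a Pa); rewrite SubK. Qed.

Lemma V_nilP c (x : g) a : real_root (g := g) c -> root_space c x -> P a ->
  loc_nil (rcomm (jA (iU x))) a.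
Proof. by move=> cr xc Pa; have := V_nil cr xc (Sub a Pa); rewrite SubK. Qed.

Lemma simple_real_root (i : 'I_(rk g)) : real_root (g := g) (delta_mx 0 i).
Proof. by exists [::], i. Qed.

Lemma chev_e_root_space (i : 'I_(rk g)) : root_space (delta_mx 0 i) (chev_e i).
Proof. by move=> h; rewrite lie_he weight_delta. Qed.

Lemma chev_f_root_space (i : 'I_(rk g)) : root_space (- delta_mx 0 i) (chev_f i).
Proof.
move=> h; rewrite lie_hf -weight_delta; congr (_ *: _).
by rewrite /weight -sumrN; apply: eq_bigr => j _; rewrite [in RHS]mxE rmorphN mulNr.
Qed.

Lemma V_weight_int (mu : 'Hom(cartan g, K^o)) a : P a -> a != 0 ->
  (forall h, rcomm (jA (iU (inc g h))) a = (mu h : K) *: a) ->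
  forall c, exists k : int, (mu (root_h d c) : K) = k%:~R.
Proof.
move=> Pa a0 amu c.
have simple i : exists k : int, (mu (coroot i) : K) = k%:~R.
  pose ad x : {linear A -> A} := rcomm (jA (iU x)).
  apply: (@sl2_weight_int _ _ (ad (chev_e i)) (ad (chev_f i)) (ad (inc g (coroot i)))
    _ _ _ P _ _ _ _ _ Pa a0 (amu _)).
  - move=> v; apply/eqP; rewrite addrC -subr_eq; apply/eqP.
    transitivity (rcomm (jA (iU (lie (chev_e i) (chev_f i)))) v); first by rewrite rcomm_lie.
    by rewrite lie_ef eqxx.
  - move=> v; apply/eqP; rewrite addrC -subr_eq; apply/eqP.
    by rewrite -[LHS]rcomm_lie lie_he sroot_coroot_ii !linearZ /= rcommZl.
  - move=> v; apply/eqP; rewrite addrC -subr_eq; apply/eqP.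
    by rewrite -[LHS]rcomm_lie lie_hf sroot_coroot_ii !linearZ /= rcommZl scaleNr scalerN.
  - by move=> v; apply: V_stableP.
  - by move=> v; apply: V_nilP (simple_real_root i) (chev_e_root_space i).
  - by move=> v; apply: V_nilP (real_rootN (simple_real_root i)) (chev_f_root_space i).
have [z ->] := root_h_coroot d_sym c.
have [k kP] := choice simple.
exists (\sum_i z i * k i); rewrite linear_sum rmorph_sum; apply: eq_bigr => i _ /=.
by rewrite linearZ /= kP intrM.
Qed.

Lemma A_nil c (x : g) : real_root (g := g) c -> root_space c x ->
  forall a, loc_nil (rcomm (jA (iU x))) a.
Proof.
move=> cr xc.
have nilM a b : loc_nil (rcomm (jA (iU x))) a -> loc_nil (rcomm (jA (iU x))) b ->
    loc_nil (rcomm (jA (iU x))) (a * b).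
  apply: (loc_nil_mul (mu := fun a b => a * b) (rcommM (jA (iU x)))).
    by move=> b'; rewrite mul0r.
  by move=> a'; rewrite mulr0.
have nilU u : loc_nil (rcomm (jA (iU x))) (jA u).
  apply: (enveloping_ind (P := fun u => loc_nil (rcomm (jA (iU x))) (jA u)) U_env).
  - by exists 1%N; rewrite rmorph1 /= /rcomm mul1r mulr1 subrr.
  - by move=> k y z Hy Hz; rewrite linearP; apply: loc_nil_lin.
  - by move=> y z Hy Hz; rewrite rmorphM; apply: nilM.
  move=> y; have [n yn] := real_root_ad_nil cr xc y; exists n.
  rewrite -[LHS]/(iter n (rcomm (jA (iU x))) (jA (iU y))).
  suff -> : iter n (rcomm (jA (iU x))) (jA (iU y)) = jA (iU (iter n (lie x) y)).
    by rewrite yn !linear0.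
  by elim: n {yn} => //= n ->; rewrite rcomm_iU.
apply: (tensor_ind (P := loc_nil (rcomm (jA (iU x)))) _ _ V_tensor).
- by exists 0%N.
- by move=> k y z; apply: loc_nil_lin.
- by move=> u v; apply: nilM => //; apply: (V_nilP cr xc); apply: valP.
Qed.

End Admissible.
End Setup.

(** * Spanning sets of the localized algebra *)

Section Localized.
Variables (K : numFieldType) (g : contragredient K) (d : 'I_(rk g) -> nat).
Hypothesis d_sym : symmetrizer (cmat g) d.
Variables (U : algType K) (iU : {linear g -> U}).
Hypothesis U_env : is_enveloping iU.
Variables (A : algType K) (jA : {lrmorphism U -> A}).
Hypothesis A_adm : admissible iU jA.
Variables (Uh : comAlgType K) (iH : {linear abelian_lie (cartan g) -> Uh}).
Hypothesis Uh_env : is_enveloping iH.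
Variable m : {lrmorphism Uh -> U}.
Hypothesis m_inc : forall h : cartan g, m (iH h) = iU (inc g h).
Variables (D : comUnitAlgType K) (l : {lrmorphism Uh -> D}).
Hypothesis D_loc : is_localization (denominator d iH) l.
Variables (A' : algType K) (dA : {lrmorphism D -> A'}) (iA : {lrmorphism A -> A'}).
Hypothesis A'_loc : is_localized_algebra m jA l dA iA.

Lemma dA_l u : dA (l u) = iA (jA (m u)).
Proof.
have [[_ _ bal] _] := A'_loc.
by have := bal 1 u 1; rewrite mul1r mulr1 !rmorph1 mulr1 mul1r.
Qed.

Lemma left_span (P : A' -> Prop) : P 0 -> (forall x y, P x -> P y -> P (x + y)) ->
  (forall a x, P (dA x * iA a)) -> forall z, P z.
Proof.
move=> P0 PD Pg z.
(* [P] is only assumed additive, and [tensor_ind] asks for a subspace. *)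
pose Q z := forall k : K, P (k *: z).
suff: Q z by move=> /(_ 1); rewrite scale1r.
apply: (tensor_ind (P := Q) _ _ A'_loc) => [k|c x y Qx Qy k|x a k].
- by rewrite scaler0.
- by rewrite scalerDr scalerA; apply: PD; [apply: Qx | apply: Qy].
- by rewrite scalerAl -linearZ; apply: Pg.
Qed.

Lemma root_h_unit c (k : int) : Defs.root (g := g) c ->
  l (iH (root_h d c)) + k%:~R \is a GRing.unit.
Proof.
move=> cr; have [lu _ _] := D_loc.
rewrite -(rmorph_int l) -rmorphD; apply: lu; exists [:: (c, k)]; split.
  by move=> p; rewrite inE => /eqP ->.
by rewrite big_seq1.
Qed.

Lemma loc_ind (P : D -> Prop) :
  P 1 -> (forall k x y, P x -> P y -> P (k *: x + y)) -> (forall x y, P x -> P y -> P (x * y)) ->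
  (forall x, x \is a GRing.unit -> P x -> P x^-1) ->
  (forall h : cartan g, P (l (iH h))) -> forall x, P x.
Proof.
move=> P1 Plin PM PV PH x.
have Pl u : P (l u).
  apply: (enveloping_ind (P := fun u => P (l u)) Uh_env) => //.
  - by rewrite rmorph1.
  - by move=> k y z Py Pz; rewrite linearP; apply: Plin.
  - by move=> y z Py Pz; rewrite rmorphM; apply: PM.
have [lu frac _] := D_loc; have [b [s [Ss ->]]] := frac x.
by apply: PM; [exact: Pl | apply: PV; [exact: lu | exact: Pl]].
Qed.

(** The additive span of the products a d; the impredicative form is its
induction principle. *)
Definition rspan (z : A') : Prop := forall P : A' -> Prop, P 0 ->
  (forall x y, P x -> P y -> P (x + y)) -> (forall a x, P (iA a * dA x)) -> P z.

Lemma rspan0 : rspan 0.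
Proof. by move=> P P0. Qed.

Lemma rspanD x y : rspan x -> rspan y -> rspan (x + y).
Proof. by move=> Sx Sy P P0 PD Pg; exact: PD (Sx P P0 PD Pg) (Sy P P0 PD Pg). Qed.

Lemma rspan_gen a x : rspan (iA a * dA x).
Proof. by move=> P _ _ Pg. Qed.

Lemma rspan_ind (Q : A' -> Prop) z : rspan z -> Q 0 ->
  (forall x y, Q x -> Q y -> Q (x + y)) -> (forall a x, Q (iA a * dA x)) -> Q z.
Proof. exact. Qed.

Lemma rspan_mull a z : rspan z -> rspan (iA a * z).
Proof.
move=> Sz; apply: (rspan_ind (Q := fun z => rspan (iA a * z)) Sz).
- by rewrite mulr0; apply: rspan0.
- by move=> x y Sx Sy; rewrite mulrDr; apply: rspanD.
- by move=> b x; rewrite mulrA -rmorphM; apply: rspan_gen.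
Qed.

Definition movable (a : A) := forall x, rspan (dA x * iA a).

Lemma movable_lin k a b : movable a -> movable b -> movable (k *: a + b).
Proof.
move=> Ma Mb x; rewrite linearP mulrDr -scalerAr; apply: rspanD => //.
by rewrite scalerAl -linearZ; apply: Ma.
Qed.

Lemma movable0 : movable 0.
Proof. by move=> x; rewrite raddf0 mulr0; apply: rspan0. Qed.

Lemma movable1 : movable 1.
Proof.
by move=> x; rewrite rmorph1 mulr1 -[dA x]mul1r -(rmorph1 iA); apply: rspan_gen.
Qed.

Lemma movableM a b : movable a -> movable b -> movable (a * b).
Proof.
move=> Ma Mb x; rewrite rmorphM mulrA.
apply: (rspan_ind (Q := fun z => rspan (z * iA b)) (Ma x)).
- by rewrite mul0r; apply: rspan0.
- by move=> y t Sy St; rewrite mulrDl; apply: rspanD.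
- by move=> c y; rewrite -mulrA; apply: rspan_mull; apply: Mb.
Qed.

(** Moving h_gamma + k across [a] shifts it by the integer mu(h_gamma), so it
stays a denominator. *)
Lemma movable_weight (a : A) (mu : cartan g -> K) :
  (forall h, rcomm (jA (iU (inc g h))) a = mu h *: a) ->
  (forall c, exists k : int, mu (root_h d c) = k%:~R) -> movable a.
Proof.
move=> amu muZ x; have [lu frac _] := D_loc; have [b [s [[r [rr ->]] ->]]] := frac x.
have ha (h : cartan g) : dA (l (iH h)) * iA a = iA a * dA (l (iH h) + (mu h)%:A).
  rewrite rmorphD /= mulrDr rmorph_alg mulr_algr dA_l m_inc -linearZ -amu /rcomm.
  by rewrite rmorphB !rmorphM /= addrC subrK.
have [t tu st] : exists2 t, t \is a GRing.unit &
    dA (l (\prod_(p <- r) (iH (root_h d p.1) + p.2%:~R))) * iA a = iA a * dA t.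
  elim: r rr => [|p r IHr] rr.
    by exists 1; rewrite ?unitr1 // big_nil !rmorph1 mul1r mulr1.
  have [|t tu st] := IHr; first by move=> p' p'r; apply: rr; rewrite inE p'r orbT.
  have [k kE] := muZ p.1.
  exists ((l (iH (root_h d p.1)) + (p.2 + k)%:~R) * t).
    rewrite unitrM tu andbT; apply: root_h_unit; apply: rr; exact: mem_head.
  rewrite big_cons !rmorphM -mulrA st mulrA; rewrite [in RHS]mulrA; congr (_ * _).
  rewrite rmorphD rmorph_int /= rmorphD mulrDl ha kE rmorph_int mulrzl -mulrzr -(rmorph_int dA).
  rewrite -mulrDr -rmorphD; congr (_ * dA _).
  by rewrite -addrA intrD [p.2%:~R + _]addrC scaler_int.
set s' := \prod_(p <- r) _ in st *.
have su : l s' \is a GRing.unit by apply: lu; exists r.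
have -> : dA (l b / l s') * iA a = iA (jA (m b) * a) * dA t^-1.
  rewrite rmorphM /= -mulrA (_ : dA (l s')^-1 * iA a = iA a * dA t^-1).
    by rewrite dA_l mulrA -rmorphM.
  rewrite -[LHS]mulr1 -(rmorph1 dA) -(divrr tu) rmorphM [_ * (dA t * _)]mulrA.
  by rewrite -[_ * iA a * dA t]mulrA -st !mulrA -rmorphM mulVr // rmorph1 mul1r.
exact: rspan_gen.
Qed.

Lemma movable_g (x : g) : movable (jA (iU x)).
Proof.
have adj h y k : lie (inc g h) y = k *: y -> rcomm (jA (iU (inc g h))) (jA (iU y)) = k *: jA (iU y).
  by move=> hy; rewrite (rcomm_iU U_env) hy !linearZ.
move: x; apply: chev_gen.
- split; first by rewrite !linear0; apply: movable0.
    by move=> k x y Mx My; rewrite !linearP; apply: movable_lin.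
  move=> x y Mx My; rewrite -(rcomm_iU U_env) /rcomm -[- _]scaleN1r addrC.
  by apply: movable_lin; apply: movableM.
- move=> h; apply: (movable_weight (mu := fun=> 0)) => [h'|c]; last by exists 0.
  by apply: adj; rewrite lie_hh scale0r.
- move=> i; apply: (movable_weight (mu := fun h => sroot i h)) => [h|c].
    by apply: adj; rewrite lie_he.
  by have [k kE] := weight_root_h_int d_sym (delta_mx 0 i) c; exists k; rewrite -weight_delta.
- move=> i; apply: (movable_weight (mu := fun h => - (sroot i h : K))) => [h|c].
    by apply: adj; rewrite lie_hf.
  have [k kE] := weight_root_h_int d_sym (delta_mx 0 i) c; exists (- k).
  by rewrite -weight_delta kE rmorphN.
Qed.

(** The movable elements form a subalgebra, and the algebra is generated by
weight vectors with integral weights. *)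
Lemma movableP (a : A) : movable a.
Proof.
have [P [V [V_stable V_tensor _ V_nil V_ss]]] := A_adm.
have movU u : movable (jA u).
  apply: (enveloping_ind (P := fun u => movable (jA u)) U_env).
  - by rewrite rmorph1; apply: movable1.
  - by move=> k x y Mx My; rewrite linearP; apply: movable_lin.
  - by move=> x y Mx My; rewrite rmorphM; apply: movableM.
  - exact: movable_g.
apply: (tensor_ind (P := movable) _ _ V_tensor); [exact: movable0 | exact: movable_lin |].
move=> u v; apply: movableM => //.
have [s [-> sP]] := V_ss v; rewrite raddf_sum /= big_seq.
elim/big_ind: _ => [|x y Mx My|w ws]; first exact: movable0.
  by rewrite -[x]scale1r; apply: movable_lin.
have [w0|w0] := eqVneq (val w) 0; first by rewrite w0; apply: movable0.
have [mu muP] := sP w ws.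
apply: (movable_weight (mu := fun h => (mu h : K)) muP).
exact: (V_weight_int d_sym U_env V_stable V_nil (valP w) w0 muP).
Qed.

Lemma right_span z : rspan z.
Proof.
move: z; apply: left_span; [exact: rspan0 | exact: rspanD |].
by move=> a x; apply: movableP.
Qed.

(** * The Zhelobenko map of a real root *)

Section Root.
Variables (alpha : 'rV[int]_(rk g)) (ea fa : g).
Hypotheses (alpha_real : real_root (g := g) alpha)
  (ea_root : root_space alpha ea) (fa_root : root_space (- alpha) fa)
  (ea_fa : lie ea fa = inc g (root_h d alpha)).
Variable tau : {lrmorphism D -> D}.
Hypothesis tau_h : forall h : cartan g, tau (l (iH h)) = l (iH h) + (weight alpha h)%:A.

Let e := jA (iU ea).
Let f := jA (iU fa).
Let h := l (iH (root_h d alpha)).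

Lemma e_tau x : iA e * dA (tau x) = dA x * iA e.
Proof.
pose P x := iA e * dA (tau x) = dA x * iA e.
apply: (loc_ind (P := P)) x; rewrite /P.
- by rewrite !rmorph1 mulr1 mul1r.
- by move=> k x y Px Py; rewrite !linearP mulrDr mulrDl -scalerAr -scalerAl Px Py.
- by move=> x y Px Py; rewrite !rmorphM mulrA Px -mulrA Py mulrA.
- move=> x xu Px; have txu : tau x \is a GRing.unit by apply: rmorph_unit.
  rewrite rmorphV // -[LHS]mul1r -(rmorph1 dA) -(mulVr xu) rmorphM -mulrA [dA x * _]mulrA.
  by rewrite -Px -!mulrA -rmorphM divrr // rmorph1 mulr1.
- move=> k; rewrite tau_h rmorphD /= rmorph_alg mulrDr mulr_algr dA_l m_inc.
  rewrite -linearZ -!(rmorphM iA) -linearD; congr (iA _).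
  have := rcomm_iU U_env jA (inc g k) ea; rewrite ea_root !linearZ /= -/e => <-.
  by rewrite /rcomm addrC subrK.
Qed.

Lemma f_tau x : iA f * dA x = dA (tau x) * iA f.
Proof.
pose P x := iA f * dA x = dA (tau x) * iA f.
apply: (loc_ind (P := P)) x; rewrite /P.
- by rewrite !rmorph1 mulr1 mul1r.
- by move=> k x y Px Py; rewrite !linearP mulrDr mulrDl -scalerAr -scalerAl Px Py.
- by move=> x y Px Py; rewrite !rmorphM mulrA Px -mulrA Py mulrA.
- move=> x xu Px; have txu : tau x \is a GRing.unit by apply: rmorph_unit.
  rewrite rmorphV // -[LHS]mul1r -(rmorph1 dA) -(mulVr txu) rmorphM -mulrA [dA (tau x) * _]mulrA.
  by rewrite -Px -!mulrA -rmorphM divrr // rmorph1 mulr1.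
- move=> k; rewrite tau_h rmorphD /= rmorph_alg mulrDl mulr_algl dA_l m_inc.
  rewrite -linearZ -!(rmorphM iA) -linearD; congr (iA _).
  have wN : weight (- alpha) k = - weight alpha k.
    by rewrite /weight -sumrN; apply: eq_bigr => j _; rewrite mxE rmorphN mulNr.
  have := rcomm_iU U_env jA (inc g k) fa; rewrite fa_root wN !linearZ /= -/f.
  move=> /eqP; rewrite scaleNr -subr_eq0 opprK /rcomm => /eqP fk.
  by apply/eqP; rewrite eq_sym -subr_eq0 addrAC fk.
Qed.

Lemma e_f : rcomm (iA e) (iA f) = dA h.
Proof.
rewrite dA_l m_inc -ea_fa -(rcomm_iU U_env).
by rewrite /rcomm rmorphB !rmorphM.
Qed.

Lemma alpha_root : Defs.root (g := g) alpha.
Proof.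
have w2 := weight_root_h d_sym alpha_real.
split.
  apply/eqP => a0; have /eqP := w2; rewrite /weight big1 => [|i _].
    by rewrite eq_sym pnatr_eq0.
  by rewrite a0 mxE mul0r.
exists ea; split=> //; apply/eqP => e0.
have := ea_fa; rewrite e0 lie0l -(linear0 (inc g)) => h0'; have h0 := Defs.inc_inj h0'.
have /eqP := w2; rewrite -h0 /weight big1 => [|i _]; first by rewrite eq_sym pnatr_eq0.
by rewrite linear0 mulr0.
Qed.

Lemma tau_h2 : tau h = h + 2.
Proof. by rewrite /h tau_h (weight_root_h d_sym) // scaler_nat. Qed.

Theorem zhelobenko_map_hom (q : {additive A' -> lquot (iA e)}) :
  is_zhelobenko_map dA iA e f h tau q ->
  exists qbar : dcoset (iA e) (iA f) -> lquot (iA e),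
  [/\ forall x : A', qbar (dclass (iA e) (iA f) x) = q x,
      forall a, mickelsson (qbar a)
    & forall a b, qbar (dcoset_mul dA h a b) = mickelsson_mul (qbar a) (qbar b)].
Proof.
move=> qP.
have h_unit k : h + k%:~R \is a GRing.unit by apply/root_h_unit/alpha_root.
have [P [V [V_stable V_tensor _ V_nil _]]] := A_adm.
have iA_nil x a : loc_nil (rcomm x) a -> loc_nil (rcomm (iA x)) (iA a).
  by move=> [n an]; exists n; rewrite iter_rcomm_morph an raddf0.
have e_nil a : loc_nil (rcomm e) a by apply: (A_nil U_env V_tensor V_nil alpha_real ea_root).
have f_nil a : loc_nil (rcomm f) a.
  by apply: (A_nil U_env V_tensor V_nil (real_rootN alpha_real) fa_root).
apply: (zhelobenko_hom e_tau f_tau e_f tau_h2 h_unit (erefl (iA f)) _ _ _ _ _ (erefl (iA e)) _).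
- by move=> a; apply: iA_nil.
- move=> Q Q0 QD Qg z; exact: (right_span z).
- exact: left_span.
- move=> Q QD QM QV Qg.
  have Qa k : Q k%:A.
    by apply: (Qg _ (k%:A) 0); rewrite ?rmorph_alg // scale0r addr0.
  apply: loc_ind => //; first by rewrite -[1]scale1r.
    by move=> k x y Qx Qy; apply: QD => //; rewrite -mulr_algl; apply: QM.
  by move=> k; apply: (Qg _ (jA (iU (inc g k))) (weight alpha k)); rewrite ?tau_h // dA_l m_inc.
- move=> a N x aN; rewrite qP.
  have -> : zhelobenko_series dA iA e f h a = lclass (iA e) (zseries dA (iA e) (iA f) h 0 N (iA a)).
    rewrite /zhelobenko_series (@fsum_nat _ _ N) => [|n le_Nn].
      rewrite /zseries raddf_sum; apply: eq_bigr => n _.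
      by rewrite iter_rcomm_morph /fpow /hfall mulrA.
    have an : iA (iter n (rcomm e) a) = 0.
      by rewrite -iter_rcomm_morph (iter_nil_le le_Nn aN).
    by rewrite an !mul0r scaler0 raddf0.
  by apply: (pi_mulr_tau e_tau); rewrite lreprK.
- by move=> a; apply: iA_nil.
Qed.
End Root.
End Localized.

Theorem theorem3 (R : realType)
  (* the Lie algebra, of finite growth, with its symmetrized Cartan matrix *)
  (g : contragredient R[i]) (g_growth : finite_growth g)
  (d : 'I_(rk g) -> nat) (d_sym : symmetrizer (cmat g) d)
  (* U(g) and the admissible algebra A *)
  (U : algType R[i]) (iU : {linear g -> U}) (U_env : is_enveloping iU)
  (A : algType R[i]) (jA : {lrmorphism U -> A}) (jA_inj : injective jA)
  (A_adm : admissible iU jA)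
  (* U(h) as a subalgebra of U(g), and its localization D *)
  (Uh : comAlgType R[i]) (iH : {linear abelian_lie (cartan g) -> Uh})
  (Uh_env : is_enveloping iH)
  (m : {lrmorphism Uh -> U}) (m_inc : forall h : cartan g, m (iH h) = iU (inc g h))
  (D : comUnitAlgType R[i]) (l : {lrmorphism Uh -> D})
  (D_loc : is_localization (denominator d iH) l)
  (* A' = D (x)_{U(h)} A *)
  (A' : algType R[i])
  (dA : {lrmorphism D -> A'}) (iA : {lrmorphism A -> A'})
  (A'_loc : is_localized_algebra m jA l dA iA)
  (* the real root alpha and its root vectors *)
  (alpha : 'rV[int]_(rk g)) (alpha_real : real_root (g := g) alpha)
  (ea fa : g) (ea_root : root_space alpha ea) (fa_root : root_space (- alpha) fa)
  (ea_fa : lie ea fa = inc g (root_h d alpha))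
  (* tau_alpha *)
  (tau : {lrmorphism D -> D})
  (tau_h : forall h : cartan g, tau (l (iH h)) = l (iH h) + (weight alpha h)%:A) :
  let e := jA (iU ea) in
  let f := jA (iU fa) in
  let h := l (iH (root_h d alpha)) in
  forall q : {additive A' -> lquot (iA e)},
  is_zhelobenko_map dA iA e f h tau q ->
  (* q induces a map from the double coset algebra to the Mickelsson algebra,
     which is multiplicative *)
  exists qbar : dcoset (iA e) (iA f) -> lquot (iA e),
  [/\ forall x : A', qbar (dclass (iA e) (iA f) x) = q x,
      forall a, mickelsson (qbar a)
    & forall a b, qbar (dcoset_mul dA h a b) = mickelsson_mul (qbar a) (qbar b)].
Proof.
move=> e f h q qP.
exact: (zhelobenko_map_hom d_sym U_env A_adm Uh_env m_inc D_loc A'_loc alpha_real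
          ea_root fa_root ea_fa tau_h qP).
Qed.
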